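(* Let $\mathbb{F}$ be a field. For any conditional oriented matroid $\mathcal{M}$ on a finite ground set $\mathcal{I}$, one has the Hilbert series $$\mathrm{Hilb}(\widehat{\mathcal{VG}}_{\mathcal{M}};q) = \mathrm{Hilb}(\mathbf{R}(\mathcal{Z}_{\mathcal{M}});q) = \sum_{F \in \mathcal{L}(\mathcal{M})} q^{\mathrm{codim}(F)} \cdot \mathrm{Hilb}(\mathcal{VG}_{\mathcal{M}^F};q),$$ where $\widehat{\mathcal{VG}}_{\mathcal{M}}$ is the graded big Varchenko--Gelfand ring of $\mathcal{M}$, $\mathcal{Z}_{\mathcal{M}}$ is the big locus of $\mathcal{M}$, and $\mathcal{VG}_{\mathcal{M}^F}$ is the graded (small) Varchenko--Gelfand ring of the contraction $\mathcal{M}^F$, all with coefficients in $\mathbb{F}$.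
   Context: **Conditional oriented matroids.** Let $\mathcal{I}$ be a finite set. A signed subset of $\mathcal{I}$ is a function $X : \mathcal{I} \to \{+,-,0\}$; $-X$ is obtained by exchanging $+$ and $-$. For signed subsets $X, Y$: $\mathrm{Sep}(X,Y) = \{i : X(i) = -Y(i) \neq 0\}$, and $(X \circ Y)(i) = X(i)$ if $X(i) \neq 0$, $(X\circ Y)(i) = Y(i)$ otherwise. A conditional oriented matroid on $\mathcal{I}$ is a family $\mathcal{M}$ of signed subsets of $\mathcal{I}$ (called covectors) such that (Face Symmetry) $X, Y \in \mathcal{M}$ implies $X \circ (-Y) \in \mathcal{M}$; and (Strong Elimination) if $X,Y \in \mathcal{M}$ and $i \in \mathrm{Sep}(X,Y)$, there is $Z \in \mathcal{M}$ with $Z(i) = 0$ and $Z(j) = (X\circ Y)(j)$ for all $j \in \mathcal{I} - \mathrm{Sep}(X,Y)$. A tope is a covector $X$ with $X(i) \neq 0$ for all $i \in \mathcal{I}$; $\mathcal{T}(\mathcal{M})$ is the set of topes. **Flats, contraction, codimension.** For $X \in \mathcal{M}$, $\mathrm{Flat}(X) = \{i : X(i) = 0\}$, and $\mathcal{L}(\mathcal{M}) = \{\mathrm{Flat}(X) : X \in \mathcal{M}\}$ is the poset of flats, ordered by containment; it is closed under intersection. For $F \in \mathcal{L}(\mathcal{M})$, the contraction $\mathcal{M}^F = \{X|_{\mathcal{I}-F} : X \in \mathcal{M},\ X(i) = 0 \text{ for all } i \in F\}$ is a conditional oriented matroid on $\mathcal{I} - F$. If $C \subseteq \mathcal{I}$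 is contained in at least one flat, $\overline{C}$ denotes the containment-minimal flat containing $C$. A subset $B \subseteq F$ is basic for the flat $F$ if $\overline{B} = F$, and $C \subseteq B$ with $\overline{C} = F$ implies $C = B$. Every flat $F$ has a basic set, and all basic sets of $F$ have the same cardinality, denoted $\mathrm{codim}(F)$. **Small VG rings.** $\mathrm{VG}_{\mathcal{M}}$ is the $\mathbb{F}$-algebra of functions $\mathcal{T}(\mathcal{M}) \to \mathbb{F}$ with pointwise operations. The Heaviside functions $h_i^{\pm}$ ($i \in \mathcal{I}$) are $h_i^{s}(X) = 1$ if $X(i) = s$ and $0$ otherwise, $s \in \{+,-\}$. Let $F_k \subseteq \mathrm{VG}_{\mathcal{M}}$ be the set of polynomials of degree $\leq k$ in the $h_i^\pm$, $F_{-1} = 0$. Then $\mathcal{VG}_{\mathcal{M}} = \bigoplus_{k \geq 0} F_k/F_{k-1}$. **Big VG rings.** $\widehat{\mathrm{VG}}_{\mathcal{M}}$ is the $\mathbb{F}$-algebra of functions $\mathcal{M} \to \mathbb{F}$ with pointwise operations, with Heaviside functions $h_i^{s}(X) = 1$ if $X(i) = s$ and $0$ otherwise ($X \in \mathcal{M}$, $s \in \{+,-\}$). Let $F_k$ be the set of polynomials of degree $\leq k$ in the $h_i^\pm$, $F_{-1}=0$. Then $\widehat{\mathcal{VG}}_{\mathcal{M}} = \bigoplus_{k \geq 0} F_k/F_{k-1}$. **Orbit harmonics and the big locus.** For a finite set $\mathcal{Z} \subseteq \mathbb{F}^N$ with coordinate ring $R = \mathbb{F}[x_1,\dots,x_N]$,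 $\mathbf{I}(\mathcal{Z}) \subseteq R$ is the ideal of polynomials vanishing on $\mathcal{Z}$; $\mathrm{gr}\,\mathbf{I}(\mathcal{Z})$ is the ideal generated by the top-degree homogeneous components of nonzero $f \in \mathbf{I}(\mathcal{Z})$; and $\mathbf{R}(\mathcal{Z}) = R/\mathrm{gr}\,\mathbf{I}(\mathcal{Z})$, a graded algebra. The big locus is $\mathcal{Z}_{\mathcal{M}} = \{\mathbf{z}_X : X \in \mathcal{M}\} \subseteq \mathbb{F}^{\mathcal{I} \times \{+,-,0\}}$, where $(\mathbf{z}_X)_{i,s} = 1$ if $X(i) = s$ and $0$ otherwise. **Hilbert series.** For a graded vector space $W = \bigoplus_{d\geq 0} W_d$, $\mathrm{Hilb}(W;q) = \sum_{d \geq 0} \dim(W_d)\, q^d$. *)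

(* Defs.v *)
From HB Require Import structures.
From Stdlib Require ClassicalEpsilon.
From mathcomp Require Import all_boot all_order all_algebra.
From mathcomp Require Export mpoly.

Set Implicit Arguments.
Unset Strict Implicit.
Unset Printing Implicit Defensive.

Import GRing.Theory.
Local Open Scope ring_scope.

(* Some true is +, Some false is -, None is 0. *)
Definition sign := option bool.
Definition sopp (s : sign) : sign := omap negb s.

Definition sset (I : finType) := {ffun I -> sign}.

Section COM.
Variable I : finType.
Implicit Types (X Y : sset I) (M : {set sset I}) (B C F G : {set I}).

Definition negs X : sset I := [ffun i => sopp (X i)].
Definition comps X Y : sset I := [ffun i => if X i != None then X i else Y i].
Definition Sep X Y : {set I} :=
  [set i | (X i == sopp (Y i)) && (X i != None)].

Definition face_symmetry M : Prop :=
  forall X Y, X \in M -> Y \in M -> comps X (negs Y) \in M.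

Definition strong_elimination M : Prop :=
  forall X Y i, X \in M -> Y \in M -> i \in Sep X Y ->
    exists Z : sset I, [/\ Z \in M, Z i = None &
      forall j, j \notin Sep X Y -> Z j = comps X Y j].

Definition is_COM M : Prop := face_symmetry M /\ strong_elimination M.

Definition topes M : {set sset I} :=
  [set X in M | [forall i, X i != None]].

Definition Flat X : {set I} := [set i | X i == None].
Definition flats M : {set {set I}} := [set Flat X | X in M].

(* G is the containment-minimal flat containing C.  For a conditional
   oriented matroid flats are closed under intersection, so there is at most
   one such G. *)
Definition is_closure M C G : bool :=
  minset (fun G' : {set I} => (G' \in flats M) && (C \subset G')) G.

Definition basic M F B : bool :=
  [&& B \subset F, is_closure M B F &
      [forall C : {set I}, (C \subset B) && is_closure M C F ==> (C == B)]].

(* The common cardinality of the basic sets of the flat F, read off from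
   an arbitrary one. *)
Definition codim M F : nat :=
  if [pick B : {set I} | basic M F B] is Some B then #|B| else 0%N.

Definition restr F X : sset {i : I | i \notin F} := [ffun i => X (val i)].
Definition contraction M F : {set sset {i : I | i \notin F}} :=
  [set restr F X | X in M & [forall i in F, X i == None]].

End COM.

Section Dimension.
Variables (K : fieldType) (V : lmodType K).
Implicit Types W U : V -> Prop.

(* The classes of the v i form a basis of the image of the subspace W in the
   quotient V / U, i.e. of W / U when U is contained in W. *)
Definition quot_basis W U (n : nat) (v : 'I_n -> V) : Prop :=
  [/\ forall i, W (v i),
      forall c : 'I_n -> K, U (\sum_i c i *: v i) -> forall i, c i = 0 &
      forall w, W w -> exists c : 'I_n -> K, U (w - \sum_i c i *: v i)].

(* The dimension of that image; the value is arbitrary if it is infinite. *)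
Definition quot_dim W U : nat :=
  ClassicalEpsilon.epsilon (inhabits 0%N)
    (fun n => exists v : 'I_n -> V, quot_basis W U v).

Lemma quot_basis_leq W U n m (v : 'I_n -> V) (w : 'I_m -> V) :
    U 0 -> (forall a x y, U x -> U y -> U (a *: x + y)) ->
  quot_basis W U v -> quot_basis W U w -> (m <= n)%N.
Proof.
move=> U0 Ulin [_ _ gen_v] [Ww free_w _].
have [c cP] := fin_all_exists (fun i => gen_v _ (Ww i)).
pose C := \matrix_(i < m, j < n) c i j.
suff /eqP <- : row_free C by exact: rank_leq_col.
rewrite -kermx_eq0; apply/eqP/row_matrixP=> k.
set a := row k _; have aC : a *m C = 0 by rewrite -row_mul mulmx_ker row0.
suff aw : U (\sum_i a 0 i *: w i).
  by rewrite row0; apply/rowP=> i; rewrite (free_w _ aw) mxE.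
have -> : \sum_i a 0 i *: w i = \sum_i a 0 i *: (w i - \sum_j c i j *: v j).
  rewrite -[LHS]subr0 (eq_bigr _ (fun i _ => scalerBr _ _ _)) sumrB.
  congr (_ - _); symmetry.
  rewrite (eq_bigr _ (fun i _ => scaler_sumr _ _ _ _)) exchange_big big1 //= => j _.
  rewrite (eq_bigr _ (fun i _ => scalerA _ _ _)) -scaler_suml.
  have /rowP/(_ j) := aC; rewrite !mxE => aCj.
  suff -> : \sum_i a 0 i * c i j = 0 by rewrite scale0r.
  by rewrite -[RHS]aCj; apply: eq_bigr => i _; rewrite [C _ _]mxE.
elim/big_rec: _ => // i x _ Ux; exact: Ulin.
Qed.

Lemma quot_dimE W U n (v : 'I_n -> V) :
    U 0 -> (forall a x y, U x -> U y -> U (a *: x + y)) ->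
  quot_basis W U v -> quot_dim W U = n.
Proof.
move=> U0 Ulin bv; rewrite /quot_dim.
set P := fun _ => _; have [w bw] : P (ClassicalEpsilon.epsilon (inhabits 0%N) P).
  by apply: ClassicalEpsilon.epsilon_spec; exists n, v.
by apply/eqP; rewrite eqn_leq (quot_basis_leq U0 Ulin bv bw) (quot_basis_leq U0 Ulin bw bv).
Qed.

End Dimension.

(* Formal power series in q with coefficients in nat: H d is the coefficient
   of q^d. *)
Definition series := nat -> nat.

(* q^c * H *)
Definition qshift (c : nat) (H : series) : series :=
  fun d => if (c <= d)%N then H (d - c)%N else 0%N.

Definition peval (K : fieldType) (J : finType) (p : {mpoly K[#|J|]})
    (z : {ffun J -> K}) : K :=
  p.@[fun j => z (enum_val j)].

Section VG.
Variables (K : fieldType) (I : finType).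

(* The values at X of all the Heaviside functions: (i, true) stands for h_i^+
   and (i, false) for h_i^-. *)
Definition heaviside (X : sset I) : {ffun I * bool -> K} :=
  [ffun j => (X j.1 == Some j.2)%:R].

(* Functions on a set P of signed subsets: P = topes M gives the small ring,
   P = M the big one. *)
Definition VG (P : {set sset I}) : lmodType K :=
  {ffun {X : sset I | X \in P} -> K^o}.

(* F_k.  As the operations of VG P are pointwise, the value at X of a
   polynomial in the Heaviside functions is its evaluation at heaviside X.
   msize p is 1 + the degree of p. *)
Definition VG_filt (P : {set sset I}) (k : nat) (f : VG P) : Prop :=
  exists p : {mpoly K[#|{: I * bool}|]},
    (msize p <= k.+1)%N /\ forall X, f X = peval p (heaviside (val X)).

(* F_(k-1) *)
Definition VG_filt_pred (P : {set sset I}) (k : nat) (f : VG P) : Prop :=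
  if k is k'.+1 then VG_filt k' f else f = 0.

Definition Hilb_grVG (P : {set sset I}) : series :=
  fun k => quot_dim (@VG_filt P k) (@VG_filt_pred P k).

End VG.

Definition Hilb_smallVG (K : fieldType) (I : finType) (M : {set sset I}) :=
  Hilb_grVG K (topes M).
Definition Hilb_bigVG (K : fieldType) (I : finType) (M : {set sset I}) :=
  Hilb_grVG K M.

Section OrbitHarmonics.
Variables (K : fieldType) (J : finType).
Local Notation R := {mpoly K[#|J|]}.

Definition vanishing (Z : seq {ffun J -> K}) (p : R) : Prop :=
  forall z, z \in Z -> peval p z = 0.

Definition top_component (p : R) : R := pihomog mdeg (msize p).-1 p.

Definition gr_ideal (Z : seq {ffun J -> K}) (g : R) : Prop :=
  exists (n : nat) (a f : 'I_n -> R),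
    (forall i, vanishing Z (f i) /\ f i != 0) /\
    g = \sum_i a i * top_component (f i).

(* The degree d component of R / gr I(Z) is the image of the space of
   homogeneous polynomials of degree d. *)
Definition Hilb_OH (Z : seq {ffun J -> K}) : series :=
  fun d => quot_dim (fun p : R => p \is d.-homog) (gr_ideal Z).

End OrbitHarmonics.

Definition locus_point (K : fieldType) (I : finType) (X : sset I) :
    {ffun I * sign -> K} :=
  [ffun j => (X j.1 == j.2)%:R].

Definition big_locus (K : fieldType) (I : finType) (M : {set sset I}) :
    seq {ffun I * sign -> K} :=
  [seq locus_point K X | X in M].

(* Main.v *)
From HB Require Import structures.
From Stdlib Require ClassicalEpsilon.
Require Import Defs.
From mathcomp Require Import all_boot all_order all_algebra.
From mathcomp Require Import ring zify.

Set Implicit Arguments.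
Unset Strict Implicit.
Unset Printing Implicit Defensive.

Import GRing.Theory.
Local Open Scope ring_scope.

(** All functions live on sign vectors.  For an element [i] of the ground set
let [y_i], [h_i^-] and [h_i^0] be the indicators of [X i = +], [X i = -] and
[X i = 0]; their sum is 1.  Degree bounds are strict throughout, so that the
piece [F_(k-1)] needs no special case at [k = 0].

The first equality is the principle of orbit harmonics.  Evaluation on the big
locus maps the homogeneous polynomials of degree [d] onto [F_d] modulo
[F_(d-1)], and such a polynomial lands in [F_(d-1)] iff it agrees on the locus
with a polynomial of smaller degree, i.e. iff it is the top component of a
vanishing polynomial ([gr_idealP]); the dimensions of the two quotients then
agree ([quot_basis_transfer]).

For the second equality, sort the covectors by their flats: those with flat [F]
are the topes of the contraction [M^F].  On [M] the indicator [h_F] of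
[F \subset Flat X] is the product of the [h_i^0] over a basic set of [F], hence
has degree [codim F].  Adding the flats one at a time to a down-set [U], in any
order that extends inclusion, filters the big ring by the subspaces of
functions that vanish at all covectors with flat in [U].  The claim is that the
restriction to the flat [G] added next maps the functions of degree at most [k]
onto those of degree at most [k - codim G] on the topes of [M^G].  Onto holds
because [h_G p] extends [p] ([extend_flat]).  The degree bound holds because a
function of degree at most [k] that vanishes over [U] is a sum of products
[h_F p_F] with [F] outside [U] and [deg p_F <= k - codim F]
([vanishing_flat_span], [restrict_flat]).  Summing dimensions gives [dim_filv],
and the theorem follows by taking differences in [k].

That decomposition is built up along [U], and each step amounts to one
statement ([vanishing_zero_ideal]): a function of degree at most [k] that
vanishes on the topes is a combination of the [h_i^0] with coefficients of
degree at most [k - 1].  It suffices because [h_G h_i^0] is zero on [M] or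
equals some [h_H] with [codim H <= codim G + 1].

To prove it, first describe the polynomials in the [y_i] that vanish on the
topes.  If no covector extends the partial sign vector [C], then the product
[cone C] of the [y_i] with [C i = +] and the [1 - y_i] with [C i = -] vanishes;
its degree is the size of the support of [C].  If moreover some covector is
zero on the support of [C], then by face symmetry no covector extends [-C]
either, and [cone C] and [cone (-C)] can be combined so that their leading
terms cancel, which gives a relation of degree one less.  These relations
generate all others compatibly with degrees ([vanishing_relations]), by
deletion and contraction: write [f = y_n p + q] with [p] and [q] free of [y_n].
Then [p] vanishes on the topes of the contraction at [n], so by induction it is
generated by relations of the contraction.  Strong elimination lifts each of
these to a relation of [M] that trades [y_n] times it for a polynomial without
[y_n] and of no larger degree ([relations_lift]); what remains is a relation of
the deletion of [n].  Finally, evaluate the generators on all covectors.  Since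
[1 - y_i = h_i^- + h_i^0], those of the first kind are combinations of the
[h_i^0] of the right degree.  One of the second kind reduces to the case of a
minimal [C], and is then a multiple of the product of the [h_i^0] over the
support of [C] minus any one element ([zero_ideal_min_circuit]). *)

(** * Modules spanned with degree bounds *)

Section FilteredSpan.
Variables (K : fieldType) (T : Type).
Implicit Types (f g h a : T -> K) (G : (T -> K) -> Prop)
  (B : nat -> (T -> K) -> Prop).

(** [B m f] lists generators [f] of weight [m], and each member of [G] has degree
one: [fspan G B n] is the filtered piece of weight at most [n] in the module
generated by [B] over the algebra generated by [G].  The algebra itself, the
ideals of relations and the spans of the [h_F] below all have this form. *)
Inductive fspan G B : nat -> (T -> K) -> Prop :=
| fspan0 n f of f =1 (fun=> 0) : fspan G B n f
| fspan_base m n f of B m f & (m <= n)%N : fspan G B n f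
| fspan_lin n c f g h of fspan G B n f & fspan G B n g &
    h =1 (fun x => c * f x + g x) : fspan G B n h
| fspan_gen n a f h of G a & fspan G B n f & h =1 (fun x => a x * f x) :
    fspan G B n.+1 h.

Arguments fspan_base {G B m n f}.

(** The constant 1 has weight 1, so weight [n] means degree less than [n], and
weight 0 leaves only the zero function. *)
Definition deg_lt G := fspan G (fun m f => m = 1%N /\ f =1 (fun=> 1)).

Section Basics.
Variables (G : (T -> K) -> Prop) (B : nat -> (T -> K) -> Prop).

Lemma fspan_ext n f g : fspan G B n f -> g =1 f -> fspan G B n g.
Proof.
move=> fB gf; apply: (fspan_lin (c := 1) fB (g := fun=> 0)) => [|x].
  exact: fspan0.
by rewrite gf mul1r addr0.
Qed.

Lemma fspan_mono n m f : fspan G B n f -> (n <= m)%N -> fspan G B m f.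
Proof.
move=> fB; elim: fB m => {n f}.
- by move=> n f f0 m _; exact: fspan0.
- by move=> k n f Bf kn m nm; apply: (fspan_base Bf); exact: leq_trans nm.
- by move=> n c f g h _ IHf _ IHg hE m nm; apply: (fspan_lin (IHf m nm) (IHg m nm) hE).
- move=> n a f h Ga _ IHf hE [//|m] nm.
  by apply: (fspan_gen Ga (IHf m _) hE).
Qed.

Lemma fspanD n f g : fspan G B n f -> fspan G B n g ->
  fspan G B n (fun x => f x + g x).
Proof. by move=> fB gB; apply: (fspan_lin (c := 1) fB gB) => x; rewrite mul1r. Qed.

Lemma fspanZ n c f : fspan G B n f -> fspan G B n (fun x => c * f x).
Proof.
move=> fB; apply: (fspan_lin fB (g := fun=> 0) (c := c)) => [|x].
  exact: fspan0.
by rewrite addr0.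
Qed.

Lemma fspanB n f g : fspan G B n f -> fspan G B n g ->
  fspan G B n (fun x => f x - g x).
Proof.
by move=> fB gB; apply: (fspan_lin (c := -1) gB fB) => x; rewrite mulN1r addrC.
Qed.

End Basics.

Section Products.
Variables (G : (T -> K) -> Prop) (B : nat -> (T -> K) -> Prop).

Lemma deg_lt0 f : deg_lt G 0 f -> f =1 (fun=> 0).
Proof.
move=> fP; have [n n0] : exists n, n = 0%N by exists 0%N.
rewrite -n0 in fP; elim: fP n0 => {n f}.
- by [].
- by move=> m n f [m1 _] mn n0; rewrite m1 n0 in mn.
- by move=> n c f g h _ IHf _ IHg hE n0 x; rewrite hE IHf // IHg // mulr0 addr0.
- by [].
Qed.

Lemma deg_lt_cst n c : deg_lt G n.+1 (fun=> c).
Proof.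
apply: fspan_ext (fspanZ c (f := fun=> 1) _) _; last by move=> x; rewrite mulr1.
exact: (fspan_base (conj erefl (frefl _))).
Qed.

(** The predecessor converts degrees less than [j] and less than [n] into
weights: a product of degree at most [(j - 1) + (n - 1)] has weight
[j + n - 1]. *)
Lemma fspan_mul j n f g : deg_lt G j f -> fspan G B n g ->
  fspan G B (j + n).-1 (fun x => f x * g x).
Proof.
move=> fP gB; elim: fP => {j f}.
- by move=> j f f0; apply: fspan0 => x; rewrite f0 mul0r.
- move=> m j f [-> f1] j_gt0.
  apply: fspan_ext (fspan_mono gB _) (_ : _ =1 g); first by lia.
  by move=> x; rewrite f1 mul1r.
- move=> j c f f' h _ IHf _ IHf' hE; apply: (fspan_lin (c := c) IHf IHf') => x.
  by rewrite hE; ring.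
- move=> j a f h Ga fP IHf hE; case: (posnP j) => [j0|j_gt0].
    rewrite {}j0 in fP; apply: fspan0 => x; by rewrite hE (deg_lt0 fP) mulr0 mul0r.
  have -> : (j.+1 + n).-1 = (j + n).-1.+1 by lia.
  by apply: (fspan_gen Ga IHf) => x; rewrite hE mulrA.
Qed.

End Products.

Lemma deg_lt_gen G a : G a -> deg_lt G 2 a.
Proof.
move=> Ga; apply: (fspan_gen Ga (deg_lt_cst G 0 1)) => x; by rewrite mulr1.
Qed.

Lemma deg_lt_prod G (J : Type) (r : seq J) (F : J -> T -> K) :
  (forall i, deg_lt G 2 (F i)) ->
  deg_lt G (size r).+1 (fun x => \prod_(i <- r) F i x).
Proof.
move=> FP; elim: r => [|i r IHr] /=.
  by apply: fspan_ext (deg_lt_cst G 0 1) _ => x; rewrite big_nil.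
by apply: fspan_ext (fspan_mul (FP i) IHr) _ => x; rewrite big_cons.
Qed.

End FilteredSpan.

(** Substituting along [t] and multiplying by [w] is linear over substitution, so
it is enough to bound it on the generators. *)
Lemma fspan_transfer (K : fieldType) (T T' : Type) (t : T' -> T) (w : T' -> K)
    (s : nat) G B G' B' :
    (forall a, G a -> deg_lt G' 2 (a \o t)) ->
    (forall m f, B m f -> fspan G' B' (m + s) (fun x => w x * f (t x))) ->
  forall n (f : T -> K), fspan G B n f ->
    fspan G' B' (n + s) (fun x => w x * f (t x)).
Proof.
move=> GG' BB' n f; elim=> {n f}.
- by move=> n f f0; apply: fspan0 => x; rewrite f0 mulr0.
- by move=> m n f Bf mn; apply: fspan_mono (BB' _ _ Bf) _; rewrite leq_add2r.
- move=> n c f g h _ IHf _ IHg hE; apply: (fspan_lin (c := c) IHf IHg) => x.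
  by rewrite hE; ring.
- move=> n a f h Ga _ IHf hE.
  have := fspan_mul (GG' _ Ga) IHf; rewrite addSn /= => aB.
  by apply: fspan_ext aB _ => x /=; rewrite hE; ring.
Qed.

Lemma deg_lt_pull (K : fieldType) (T T' : Type) (t : T' -> T)
    (G : (T -> K) -> Prop) (G' : (T' -> K) -> Prop) :
    (forall a, G a -> deg_lt G' 2 (a \o t)) ->
  forall n f, deg_lt G n f -> deg_lt G' n (f \o t).
Proof.
move=> GG' n f fP.
have := @fspan_transfer _ _ _ t (fun=> 1) 0 G _ G' _ GG' _ n f fP.
rewrite addn0 => H; apply: fspan_ext (H _ _) _ => [m g [-> g1]|x] /=.
  by apply: fspan_ext (deg_lt_cst G' 0 1) _ => x; rewrite g1 mulr1.
by rewrite mul1r.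
Qed.

Lemma fspan_sum (K : fieldType) (T : Type) (G : (T -> K) -> Prop) B n
    (J : eqType) (r : seq J) (F : J -> T -> K) :
    (forall i, i \in r -> fspan G B n (F i)) ->
  fspan G B n (fun x => \sum_(i <- r) F i x).
Proof.
elim: r => [_|i r IHr FB]; first by apply: fspan0 => x; rewrite big_nil.
apply: fspan_ext (fspanD (FB i _) (IHr _)) _ => [|j jr|x].
- exact: mem_head.
- by apply: FB; rewrite inE jr orbT.
- by rewrite big_cons.
Qed.

Lemma deg_lt_monomial (K : fieldType) (T : Type) (G : (T -> K) -> Prop)
    (J : Type) (r : seq J) (g : J -> T -> K) (e : J -> nat) :
    (forall j, G (g j)) ->
  deg_lt G (\sum_(j <- r) e j).+1 (fun x => \prod_(j <- r) g j x ^+ e j).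
Proof.
move=> Gg; elim: r => [|j r IHr].
  by apply: fspan_ext (deg_lt_cst G _ 1) _ => x; rewrite big_nil.
have powP k : deg_lt G k.+1 (fun x => g j x ^+ k).
  elim: k => [|k IHk]; first exact: (deg_lt_cst G 0 1).
  by apply: (fspan_gen (Gg j) IHk) => x; rewrite exprS.
apply: fspan_ext (fspan_mono (fspan_mul (powP (e j)) IHr) _) _ => [|x].
  by rewrite big_cons addnS.
by rewrite big_cons.
Qed.

(** The link to the polynomials that define the filtrations of the graded rings. *)
Lemma deg_lt_mpoly (K : fieldType) (T : Type) (J : finType) (z : T -> {ffun J -> K})
    n (f : T -> K) :
  deg_lt (fun a => exists j, a =1 fun x => z x j) n f <->
  exists p : {mpoly K[#|J|]}, (msize p <= n)%N /\ forall x, f x = peval p (z x).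
Proof.
split.
  elim=> {n f}.
  - move=> n f f0; exists 0; rewrite msize0; split=> // x.
    by rewrite f0 /peval meval0.
  - move=> m n f [-> f1] n_gt0; exists 1; rewrite msize1; split=> // x.
    by rewrite f1 /peval meval1.
  - move=> n c f g h _ [p [pn pE]] _ [q [qn qE]] hE; exists (c *: p + q).
    split=> [|x]; last by rewrite hE pE qE /peval mevalD mevalZ.
    apply: leq_trans (msizeD_le _ _) _; rewrite geq_max qn andbT.
    exact: leq_trans (msizeZ_le _ _) pn.
  - move=> n a f h [j aE] _ [p [pn pE]] hE; exists ('X_(enum_rank j) * p).
    split=> [|x]; last by rewrite hE aE pE /peval mevalM mevalXU enum_rankK.
    case: (eqVneq p 0) => [->|p0]; first by rewrite mulr0 msize0.
    have X0 : (@mpolyX _ K U_(enum_rank j)) != 0 by rewrite -msize_poly_eq0 msizeX.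
    by rewrite msizeM // msizeX mdeg1.
case=> p [pn pE]; apply: (@fspan_ext _ _ _ _ _ (fun x => peval p (z x))) => //.
apply: (@fspan_ext _ _ _ _ _
    (fun x => \sum_(m <- msupp p) p@_m * \prod_i z x (enum_val i) ^+ m i)).
  apply: fspan_sum => m mp; apply: fspanZ.
  pose g (i : 'I_#|J|) x := z x (enum_val i).
  have gP i : exists j, g i =1 fun x => z x j by exists (enum_val i).
  apply: fspan_mono (deg_lt_monomial (G := fun a => exists j, a =1 fun x => z x j)
    (index_enum _) m gP) _.
  by rewrite -mdegE; apply: leq_trans (msize_mdeg_lt mp) pn.
by move=> x; rewrite /peval mevalE.
Qed.

(** * Covectors and partial sign vectors *)

Section Covectors.
Variable I : finType.
Implicit Types (X Y Z C : sset I) (M : {set sset I}) (F S : {set I}).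

Lemma soppK : involutive sopp.
Proof. by case=> // b; rewrite /= negbK. Qed.

Lemma compsE X Y i : comps X Y i = if X i == None then Y i else X i.
Proof. by rewrite ffunE; case: (X i). Qed.

Lemma comps_neg_closed M X Y :
  is_COM M -> X \in M -> Y \in M -> comps X (negs Y) \in M.
Proof. by case=> + _; exact. Qed.

(** Face symmetry applied twice: the two sign changes cancel where [X] is zero. *)
Lemma comps_closed M X Y : is_COM M -> X \in M -> Y \in M -> comps X Y \in M.
Proof.
move=> hM XM YM; have := comps_neg_closed hM XM (comps_neg_closed hM XM YM).
suff -> : comps X (negs (comps X (negs Y))) = comps X Y by [].
apply/ffunP=> i; rewrite !compsE ffunE compsE ffunE.
by case: eqP => // _; rewrite soppK.
Qed.

Lemma eliminate M X Y i b : is_COM M -> X \in M -> Y \in M ->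
    X i = Some b -> Y i = Some (~~ b) ->
  exists Z, [/\ Z \in M, Z i = None &
    forall j, (X j == None) || (X j != sopp (Y j)) -> Z j = comps X Y j].
Proof.
case=> _ elim XM YM Xi Yi.
have [|Z [ZM Zi ZE]] := elim X Y i XM YM; first by rewrite inE Xi Yi /= negbK eqxx.
by exists Z; split=> // j Xj; apply: ZE; rewrite inE negb_and negbK orbC.
Qed.

(** The contraction [M^F] seen inside the ground set of [M], with zeros on [F];
this avoids changing the ground set in inductions. *)
Definition face_at M F : {set sset I} := [set X in M | F \subset Flat X].

Lemma face_atP M F X :
  reflect (X \in M /\ forall i, i \in F -> X i = None) (X \in face_at M F).
Proof.
rewrite inE; apply: (iffP andP) => -[XM]; last first.
  by move=> X0; split=> //; apply/subsetP=> i /X0 Xi; rewrite inE Xi.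
by move=> /subsetP FX; split=> // i /FX; rewrite inE => /eqP.
Qed.

Lemma face_at_COM M F : is_COM M -> is_COM (face_at M F).
Proof.
move=> hM; split=> [X Y|X Y i] /face_atP[XM X0] /face_atP[YM Y0].
  apply/face_atP; split=> [|i iF]; first exact: comps_neg_closed.
  by rewrite compsE X0 // eqxx ffunE Y0.
case: (hM) => _ elim /elim [//|//|Z [ZM Zi ZE]]; exists Z; split=> //.
apply/face_atP; split=> // j jF; rewrite ZE ?compsE ?X0 ?Y0 //.
by rewrite inE X0 // eqxx andbF.
Qed.

(** A partial sign vector is a sign vector [C] read on its support only: a zero
entry imposes no condition on the covectors that extend [C]. *)
Definition supp C : {set I} := ~: Flat C.

Lemma suppE C i : (i \in supp C) = (C i != None).
Proof. by rewrite !inE. Qed.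

Lemma supp_negs C : supp (negs C) = supp C.
Proof. by apply/setP=> i; rewrite !suppE ffunE; case: (C i). Qed.

Definition extends C X := [forall i in supp C, X i == C i].

Lemma extendsP C X : reflect {in supp C, X =1 C} (extends C X).
Proof.
apply: (iffP forall_inP) => XC i iC; last by rewrite XC.
by apply/eqP/XC.
Qed.

Definition unrealized M C := forall X, X \in M -> ~~ extends C X.

Definition centered M C :=
  exists2 Z, Z \in M & forall i, i \in supp C -> Z i = None.

Lemma centered_supp M C C' : supp C' \subset supp C -> centered M C -> centered M C'.
Proof. by move=> /subsetP CC' [Z ZM Z0]; exists Z => // i /CC'/Z0. Qed.

(** If [Z] is zero on the support of [C] and [X] extends [-C], then [Z o (-X)]
extends [C]. *)
Lemma unrealized_negs M C : is_COM M -> centered M C -> unrealized M C ->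
  unrealized M (negs C).
Proof.
move=> hM [Z ZM Z0] nC X XM; apply/negP=> /extendsP XC.
have /negP[] := nC _ (comps_neg_closed hM ZM XM); apply/extendsP=> i iC.
by rewrite compsE Z0 // eqxx ffunE XC ?supp_negs // ffunE soppK.
Qed.

Definition upd C n s : sset I := [ffun i => if i == n then s else C i].

Lemma supp_upd C n b : supp (upd C n (Some b)) = n |: supp C.
Proof. by apply/setP=> i; rewrite in_setU1 !suppE ffunE; case: (i == n). Qed.

Lemma negs_upd C n s : negs (upd C n s) = upd (negs C) n (sopp s).
Proof. by apply/ffunP=> i; rewrite !ffunE; case: eqP. Qed.

Lemma extends_upd C n b X : n \notin supp C ->
  extends (upd C n (Some b)) X = (X n == Some b) && extends C X.
Proof.
move=> nC; apply/extendsP/andP.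
  move=> XC; split; first by rewrite XC ?supp_upd ?setU11 // ffunE eqxx.
  apply/extendsP=> i iC; rewrite XC ?supp_upd ?setU1r // ffunE.
  by case: eqP => // ni; rewrite -ni iC in nC.
move=> [/eqP Xn /extendsP XC] i; rewrite supp_upd ffunE in_setU1.
by case: eqP => [->|_ /= /XC].
Qed.

(** If both signs at [n] could be realized together with [C], eliminating [n]
would give a covector that is zero at [n] and still extends [C]. *)
Lemma unrealized_lift M C n : is_COM M -> n \notin supp C ->
  unrealized (face_at M [set n]) C -> exists b, unrealized M (upd C n (Some b)).
Proof.
move=> hM nC nonC.
have [/existsP[X /andP[XM XC]]|/existsPn none] :=
    boolP [exists X, (X \in M) && extends (upd C n (Some true)) X]; last first.
  by exists true => X XM; have := none X; rewrite XM.
exists false => Y YM; apply/negP=> YC.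
move: XC YC; rewrite !extends_upd // => /andP[/eqP Xn /extendsP XC].
move=> /andP[/eqP Yn /extendsP YC].
have [Z [ZM Zn ZE]] := eliminate hM XM YM Xn Yn.
have ZMn : Z \in face_at M [set n].
  by apply/face_atP; split=> // i /set1P->.
have /negP[] := nonC _ ZMn; apply/extendsP=> i iC.
have Ci : C i != None by rewrite -suppE.
rewrite ZE; first by rewrite compsE XC // (negPf Ci).
by rewrite XC // YC // orbC; case: (C i) Ci => [[]|].
Qed.

End Covectors.

(** * Relations among the positive Heaviside functions on topes *)

Section Relations.
Variables (K : fieldType) (I : finType).
Implicit Types (X Y Z C : sset I) (M : {set sset I}) (F S : {set I}).

Definition ind (i : I) (s : sign) : sset I -> K := fun X => (X i == s)%:R.

(** [y_i] or [1 - y_i]: a covector that is zero at [i] counts as negative. *)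
Definition lit (i : I) (b : bool) : sset I -> K :=
  fun X => ((X i == Some true) == b)%:R.

Lemma litN i b X : lit i (~~ b) X = 1 - lit i b X.
Proof.
by rewrite /lit; case: b; case: (X i == _); rewrite /= ?mulr1n ?mulr0n ?subrr ?subr0.
Qed.

(** On topes, the indicator of the region cut out by [C]. *)
Definition cone C : sset I -> K :=
  fun X => \prod_(i in supp C) lit i (C i == Some true) X.

(** The sign makes the two leading monomials cancel, so that the degree drops
below the size of the support. *)
Definition circuit_rel C : sset I -> K :=
  fun X => cone C X - (-1) ^+ #|supp C| * cone (negs C) X.

Lemma cone_upd C n b X : n \notin supp C ->
  cone (upd C n (Some b)) X = lit n b X * cone C X.
Proof.
move=> nC; rewrite /cone supp_upd big_setU1 //= ffunE eqxx; congr (_ * _).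
  by case: b.
apply: eq_bigr => i iC; rewrite ffunE; case: (i =P n) => // ni.
by rewrite -ni iC in nC.
Qed.

(** This recursion replaces the expansion of [circuit_rel]: it trades a literal
times a relation for a relation on one more element and a [cone]. *)
Lemma circuit_upd C n b X : n \notin supp C ->
  circuit_rel (upd C n (Some b)) X =
    lit n b X * circuit_rel C X + (-1) ^+ #|supp C| * cone (negs C) X.
Proof.
move=> nC; rewrite /circuit_rel negs_upd !cone_upd ?supp_negs // litN supp_upd.
by rewrite cardsU1 nC exprS; ring.
Qed.

Lemma prod_bool (J : finType) (A : {set J}) (P : pred J) :
  \prod_(i in A) (P i)%:R = [forall i in A, P i]%:R :> K.
Proof.
case: (boolP [forall i in A, P i]) => [/forall_inP AP|].
  by rewrite big1 // => i /AP ->.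
by rewrite negb_forall_in => /exists_inP[i iA /negPf Pi]; rewrite (bigD1 i) //= Pi mul0r.
Qed.

Lemma cone_tope C X : (forall i, i \in supp C -> X i != None) ->
  cone C X = (extends C X)%:R.
Proof.
move=> X0; rewrite /cone prod_bool; congr (nat_of_bool _)%:R.
apply: eq_forallb => i; case: (boolP (i \in supp C)) => //= iC.
by have := X0 i iC; rewrite suppE in iC; case: (X i) (C i) iC => [[]|] [[]|].
Qed.

(** The [y_i] alone, because [1 - y_i] agrees with [h_i^-] on topes. *)
Definition plus_gens S : (sset I -> K) -> Prop :=
  fun a => exists2 i, i \in S & a = ind i (Some true).

(** Generators of the ideal of relations, weighted by degree plus one. *)
Definition relation_base M S : nat -> (sset I -> K) -> Prop := fun m f =>
  exists C, [/\ supp C \subset S, unrealized M C &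
    (m = #|supp C|.+1 /\ f = cone C) \/
    [/\ centered M C, m = #|supp C| & f = circuit_rel C]].

Definition relations M S := fspan (plus_gens S) (relation_base M S).

(** The topes of the deletion to [S], kept as covectors of [M]. *)
Definition nonzero_on M S : {set sset I} :=
  [set X in M | [forall i in S, X i != None]].

Lemma nonzero_onP M S X :
  reflect (X \in M /\ forall i, i \in S -> X i != None) (X \in nonzero_on M S).
Proof. by rewrite inE; apply: (iffP andP) => -[XM /forall_inP]. Qed.

Lemma relations_vanish M S n f : is_COM M -> relations M S n f ->
  forall X, X \in nonzero_on M S -> f X = 0.
Proof.
move=> hM; elim=> {n f}.
- by move=> n f f0 X _; rewrite f0.
- move=> m n f [C [/subsetP CS nC fE]] _ X /nonzero_onP[XM X0].
  have XC i : i \in supp C -> X i != None by move/CS/X0.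
  have h0 D : unrealized M D -> supp D = supp C -> cone D X = 0.
    by move=> nD DC; rewrite cone_tope ?DC // (negPf (nD X XM)).
  case: fE => [[_ ->]|[cC _ ->]]; first exact: h0.
  by rewrite /circuit_rel !h0 ?supp_negs ?mulr0 ?subrr //; apply: unrealized_negs.
- by move=> n c f g h _ IHf _ IHg hE X XM; rewrite hE IHf // IHg // mulr0 addr0.
- by move=> n a f h _ _ IHf hE X XM; rewrite hE IHf // mulr0.
Qed.

Lemma deg_lt_lit S i b : i \in S -> deg_lt (plus_gens S) 2 (lit i b).
Proof.
move=> iS.
have litT : deg_lt (plus_gens S) 2 (lit i true).
  apply: fspan_ext (deg_lt_gen (a := ind i (Some true)) _) _; first by exists i.
  by move=> X; rewrite /lit eqb_id.
case: b => //.
by apply: fspan_ext (fspanB (deg_lt_cst _ 1 1) litT) _ => X; rewrite -(litN i true).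
Qed.

Lemma deg_lt_prod_set G (J : finType) (A : {set J}) (F : J -> sset I -> K) :
    (forall i, i \in A -> deg_lt G 2 (F i)) ->
  deg_lt G #|A|.+1 (fun X => \prod_(i in A) F i X).
Proof.
move=> FP; rewrite cardE.
have rA : {subset enum A <= A} by move=> i; rewrite mem_enum.
apply: (@fspan_ext _ _ _ _ _ (fun X => \prod_(i <- enum A) F i X)); last first.
  by move=> X; rewrite big_enum.
elim: (enum A) rA => [|i r IHr] rA.
  by apply: fspan_ext (deg_lt_cst G 0 1) _ => X; rewrite big_nil.
have FiP : deg_lt G 2 (F i) by apply/FP/rA/mem_head.
apply: fspan_ext (fspan_mul FiP (IHr _)) _ => [j jr|X]; last by rewrite big_cons.
by apply: rA; rewrite inE jr orbT.
Qed.

Lemma deg_lt_cone S C : supp C \subset S -> deg_lt (plus_gens S) #|supp C|.+1 (cone C).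
Proof. by move=> /subsetP CS; apply: deg_lt_prod_set => i /CS /deg_lt_lit. Qed.

Lemma deg_lt_local S n f X Y : deg_lt (plus_gens S) n f ->
  {in S, X =1 Y} -> f X = f Y.
Proof.
move=> fP XY; elim: fP => {n f}.
- by move=> n f f0; rewrite !f0.
- by move=> m n f [_ f1] _; rewrite !f1.
- by move=> n c f g h _ IHf _ IHg hE; rewrite !hE IHf IHg.
- by move=> n a f h [i iS ->] _ IHf hE; rewrite !hE IHf /ind XY.
Qed.

Lemma plus_gens_sub S S' : S \subset S' -> forall a, plus_gens S a -> plus_gens S' a.
Proof. by move=> /subsetP SS' a [i /SS' iS ->]; exists i. Qed.

Lemma deg_lt_plus_sub S S' n f : S \subset S' ->
  deg_lt (plus_gens S) n f -> deg_lt (plus_gens S') n f.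
Proof.
move=> SS' /(deg_lt_pull (t := id)); apply=> a /(plus_gens_sub SS')/deg_lt_gen; exact.
Qed.

Lemma relations_sub M S S' n f : S \subset S' -> relations M S n f -> relations M S' n f.
Proof.
move=> SS'; elim=> {n f}.
- by move=> n f f0; apply: fspan0.
- move=> m n f [C [CS nC fE]] mn; apply: fspan_base mn; exists C; split=> //.
  exact: subset_trans SS'.
- by move=> n c f g h _ IHf _ IHg; apply: fspan_lin.
- by move=> n a f h /(plus_gens_sub SS') Ga _ IHf; apply: fspan_gen.
Qed.

Lemma relations_mul M S j n f g : deg_lt (plus_gens S) j f -> relations M S n g ->
  relations M S (j + n).-1 (fun X => f X * g X).
Proof. exact: fspan_mul. Qed.

Lemma relations_cone M S C : supp C \subset S -> unrealized M C ->
  relations M S #|supp C|.+1 (cone C).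
Proof.
move=> CS nC; apply: (@fspan_base _ _ _ _ #|supp C|.+1) => //.
by exists C; split=> //; left.
Qed.

Lemma relations_circuit M S C : supp C \subset S -> unrealized M C -> centered M C ->
  relations M S #|supp C| (circuit_rel C).
Proof.
move=> CS nC cC; apply: (@fspan_base _ _ _ _ #|supp C|) => //.
by exists C; split=> //; right.
Qed.

(** The step from the contraction at [n] to [M].  A generator of the contraction
on the support of [C] lifts to a generator of [M] on that support together with
[n], for one of the two signs [b] at [n].  Expanding the literal at [n] in the
lifted generator expresses [y_n] times the original one through polynomials
free of [y_n]. *)
Lemma relations_lift M S n k p : is_COM M -> n \notin S ->
    relations (face_at M [set n]) S k p ->
  exists2 q, deg_lt (plus_gens S) k.+1 q &
    relations M (n |: S) k.+1 (fun X => lit n true X * p X - q X).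
Proof.
move=> hM nS; elim=> {k p}.
- move=> k p p0; exists (fun=> 0); first exact: fspan0.
  by apply: fspan0 => X; rewrite p0 mulr0 subrr.
- move=> m k p [C [CS nonC pE]] mk.
  have nC : n \notin supp C by apply: contra nS; apply: subsetP.
  have [b nonCb] := unrealized_lift hM nC nonC.
  have CbS : supp (upd C n (Some b)) \subset n |: S.
    by rewrite supp_upd setUS.
  suff [q qP rP] : exists2 q, deg_lt (plus_gens S) m.+1 q &
      relations M (n |: S) m.+1 (fun X => lit n true X * p X - q X).
    exists q; first by apply: fspan_mono qP _.
    by apply: fspan_mono rP _.
  case: pE => [[-> ->]|[cC -> ->]].
    have rP := relations_cone CbS nonCb; rewrite supp_upd cardsU1 nC add1n in rP.
    exists (fun X => (~~ b)%:R * cone C X).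
      by apply: fspanZ; apply: fspan_mono (deg_lt_cone CS) _.
    apply: fspan_ext (fspanZ (if b then 1 else -1) rP) _ => X.
    rewrite cone_upd //; case: b {CbS nonCb rP} => /=; first by ring.
    by rewrite (litN n true); ring.
  have cCb : centered M (upd C n (Some b)).
    case: cC => Z /face_atP[ZM Zn] Z0; exists Z => // i.
    by rewrite supp_upd => /setU1P[->|/Z0 //]; apply: Zn; rewrite set11.
  have rP := relations_circuit CbS nonCb cCb; rewrite supp_upd cardsU1 nC add1n in rP.
  exists (fun X => if b then - ((-1) ^+ #|supp C| * cone (negs C) X) else cone C X).
    case: (b); last exact: deg_lt_cone.
    apply: fspan_ext (fspanZ (- (-1) ^+ #|supp C|)
      (_ : deg_lt (plus_gens S) #|supp C|.+1 (cone (negs C)))) _.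
      by rewrite -supp_negs; apply: deg_lt_cone; rewrite supp_negs.
    by move=> X; ring.
  apply: fspan_ext (fspanZ (if b then 1 else -1) rP) _ => X.
  rewrite circuit_upd //; case: b {CbS nonCb cCb rP} => /=; first by ring.
  by rewrite (litN n true) /circuit_rel; ring.
- move=> k c f g h _ [qf qfP rf] _ [qg qgP rg] hE.
  exists (fun X => c * qf X + qg X); first exact: fspan_lin qfP qgP _.
  by apply: (fspan_lin (c := c) rf rg) => X; rewrite hE; ring.
- move=> k a f h Ga _ [q qP rP] hE.
  exists (fun X => a X * q X); first exact: fspan_gen Ga qP _.
  have Ga' := plus_gens_sub (subsetUr [set n] S) Ga.
  by apply: (fspan_gen Ga' rP) => X; rewrite hE; ring.
Qed.

Lemma ind_lit n X : ind n (Some true) X = lit n true X.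
Proof. by rewrite /lit eqb_id. Qed.

(** Division by [y_n], which is exact because [y_n] is idempotent. *)
Lemma plus_split S n k f : deg_lt (plus_gens (n |: S)) k f ->
  exists p q, [/\ deg_lt (plus_gens S) k.-1 p, deg_lt (plus_gens S) k q &
    forall X, f X = lit n true X * p X + q X].
Proof.
elim=> {k f}.
- move=> k f f0; exists (fun=> 0), (fun=> 0); split; try exact: fspan0.
  by move=> X; rewrite f0 mulr0 addr0.
- move=> m k f [-> f1] k_gt0; exists (fun=> 0), (fun=> 1).
  rewrite -(prednK k_gt0) /=; split; [exact: fspan0 | exact: deg_lt_cst |].
  by move=> X; rewrite f1 mulr0 add0r.
- move=> k c f g h _ [p [q [pP qP fE]]] _ [p' [q' [p'P q'P gE]]] hE.
  exists (fun X => c * p X + p' X), (fun X => c * q X + q' X).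
  split; [exact: fspan_lin pP p'P _ | exact: fspan_lin qP q'P _ |].
  by move=> X; rewrite hE fE gE; ring.
- move=> k a f h [i + ->] _ [p [q [pP qP fE]]] hE.
  rewrite in_setU1 => /orP[/eqP ni|iS].
    exists (fun X => p X + q X), (fun=> 0); split; last first.
    + move=> X; rewrite hE fE ni ind_lit /lit.
      by case: (_ == true); rewrite /= ?mulr1n ?mulr0n; ring.
    + exact: fspan0.
    + by apply: fspanD qP; apply: fspan_mono pP _; rewrite leq_pred.
  have Ga : plus_gens S (ind i (Some true)) by exists i.
  exists (fun X => ind i (Some true) X * p X),
         (fun X => ind i (Some true) X * q X); split; last first.
  + by move=> X; rewrite hE fE; ring.
  + exact: fspan_gen Ga qP _.
  + case: k pP {qP} => [|k] pP; last exact: fspan_gen Ga pP _.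
    by apply: fspan0 => X; rewrite (deg_lt0 pP) mulr0.
Qed.

(** Composing covectors accumulates nonzero entries. *)
Lemma exists_nonzero_on M S : is_COM M -> M != set0 ->
    (forall j, j \in S -> exists2 X, X \in M & X j != None) ->
  nonzero_on M S != set0.
Proof.
move=> hM /set0Pn[X0 X0M].
have [k] := ubnP #|S|; elim: k S => // k IHk S.
case: (set_0Vmem S) => [-> _ _|[n nS]].
  by apply/set0Pn; exists X0; apply/nonzero_onP; split=> // i; rewrite inE.
rewrite (cardsD1 n) nS ltnS => /IHk IH Sne.
have [|X /nonzero_onP[XM XS]] := set0Pn _ (IH _).
  by move=> j /setD1P[_ /Sne].
have [Y YM Yn] := Sne n nS.
apply/set0Pn; exists (comps X Y); apply/nonzero_onP.
split=> [|j jS]; first exact: comps_closed.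
rewrite compsE; case: (X j =P None) => [Xj|/eqP //].
have [jn|jn] := eqVneq j n; first by rewrite jn.
by have := XS j; rewrite !inE jn jS Xj => /(_ isT).
Qed.

(** The degenerate case of the induction: when the contraction at [n] has no tope,
either the sign at [n] is constant on topes, or some [j] vanishes together with
[n] and the sign at [j] determines the one at [n].  So [y_n] is affine in the
other variables modulo relations. *)
Lemma relations_dependent M S n : is_COM M -> n \notin S ->
    nonzero_on (face_at M [set n]) S = set0 ->
  exists2 a, deg_lt (plus_gens S) 2 a &
    relations M (n |: S) 2 (fun X => lit n true X - a X).
Proof.
move=> hM nS none; pose C0 : sset I := [ffun=> None].
have C0S : supp C0 = set0 by apply/setP=> i; rewrite suppE ffunE inE.
have hC0 X : cone C0 X = 1 by rewrite /cone C0S big_set0.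
have [M0|M0] := eqVneq (face_at M [set n]) set0.
  have [||b nonCb] := @unrealized_lift _ M C0 n hM.
  - by rewrite C0S inE.
  - by move=> X; rewrite M0 inE.
  exists (fun=> (~~ b)%:R); first exact: deg_lt_cst.
  have CbS : supp (upd C0 n (Some b)) \subset n |: S.
    by rewrite supp_upd C0S setU0 subsetUl.
  have := relations_cone CbS nonCb; rewrite supp_upd C0S setU0 cards1 => rP.
  apply: fspan_ext (fspanZ (if b then 1 else -1) rP) _ => X.
  rewrite cone_upd ?C0S ?inE // hC0; case: b {nonCb CbS rP} => /=; first by ring.
  by rewrite (litN n true); ring.
have [j jS Zj] : exists2 j, j \in S &
    forall Z, Z \in face_at M [set n] -> Z j = None.
  case: (boolP [exists j in S, [forall Z in face_at M [set n], Z j == None]]).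
    by case/exists_inP=> j jS /forall_inP Zj; exists j => // Z /Zj/eqP.
  rewrite negb_exists_in => /forall_inP noj.
  suff: nonzero_on (face_at M [set n]) S != set0 by rewrite none eqxx.
  apply: exists_nonzero_on => // [|j /noj]; first exact: face_at_COM.
  by rewrite negb_forall_in => /exists_inP.
pose C := upd C0 j (Some true).
have CS : supp C = [set j] by rewrite supp_upd C0S setU0.
have nC : n \notin supp C by rewrite CS inE; apply: contraNneq nS => ->.
have [|b nonCb] := unrealized_lift hM nC.
  move=> X /Zj Xj; apply/negP=> /extendsP/(_ j).
  by rewrite CS set11 Xj ffunE eqxx => /(_ isT).
have CbS : supp (upd C n (Some b)) \subset n |: S.
  by rewrite supp_upd CS setUS // sub1set.
have cCb : centered M (upd C n (Some b)).
  case/set0Pn: M0 => Z Zn; have := Zj Z Zn.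
  case/face_atP: Zn => ZM Zn Zj0; exists Z => // i.
  by rewrite supp_upd CS => /setU1P[->|/set1P->] //; apply/Zn/set11.
have := relations_circuit CbS nonCb cCb.
rewrite supp_upd cardsU1 nC CS cards1 => rP.
exists (lit j (~~ b)); first exact: deg_lt_lit.
have hnC X : cone (negs C) X = lit j false X.
  by rewrite /cone supp_negs CS big_set1 !ffunE eqxx.
have cC X : circuit_rel C X = 1.
  by rewrite /circuit_rel hnC CS cards1 /cone CS big_set1 ffunE eqxx (litN j true) expr1; ring.
apply: fspan_ext (fspanZ (if b then 1 else -1) rP) _ => X.
rewrite circuit_upd // cC hnC CS cards1 expr1.
by case: b {nonCb CbS cCb rP} => /=; rewrite ?(litN _ true); ring.
Qed.

(** Induction on [S] by deletion and contraction of an element [n]. *)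
Theorem vanishing_relations M S k f : is_COM M -> nonzero_on M S != set0 ->
    deg_lt (plus_gens S) k f -> (forall X, X \in nonzero_on M S -> f X = 0) ->
  relations M S k f.
Proof.
have [N] := ubnP #|S|; elim: N M S k f => // N IHN M S k f SN hM.
move=> /set0Pn[W /nonzero_onP[WM WS]] fP f0.
case: k fP => [|k] fP; first by apply: fspan0; apply: deg_lt0 fP.
case: (set_0Vmem S) => [S0|[n nS]].
  apply: fspan0 => X; rewrite -(f0 W); last by apply/nonzero_onP.
  by apply: deg_lt_local fP _ => i; rewrite S0 inE.
have nS' : n \notin S :\ n by rewrite !inE eqxx.
have SE : S = n |: (S :\ n) by rewrite setD1K.
move: (S :\ n) nS' SE => S' nS' SE; rewrite SE cardsU1 nS' ltnS in SN.
have WS' i : i \in S' -> W i != None by move=> iS; apply: WS; rewrite SE setU1r.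
rewrite {}SE in WS f0 fP nS *.
have [p [q [pP qP fE]]] := plus_split fP; rewrite /= in pP.
have [q' q'P rP] : exists2 q', deg_lt (plus_gens S') k.+1 q' &
    relations M (n |: S') k.+1 (fun X => lit n true X * p X - q' X).
  have [none|some] := eqVneq (nonzero_on (face_at M [set n]) S') set0.
    have [a aP rP] := relations_dependent hM nS' none.
    exists (fun X => a X * p X); first exact: (fspan_mul aP pP).
    have pP' := deg_lt_plus_sub (subsetUr [set n] S') pP.
    apply: fspan_ext (fspan_mono (relations_mul pP' rP) _) _; first by lia.
    by move=> X; ring.
  apply: relations_lift => //; apply: IHN => //; first exact: face_at_COM.
  move=> Z /nonzero_onP[/face_atP[ZM Zn] ZS].
  have{Zn} Zn : Z n = None by rewrite Zn ?set11.
  have eqZ Y : {in S', comps Z Y =1 Z}.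
    by move=> i /ZS; rewrite compsE; case: eqP.
  (* Z o W and Z o (-W) differ on S only at n, so subtracting the values of f
     there isolates p Z. *)
  have negW : f (comps Z (negs W)) = 0.
    apply: f0; apply/nonzero_onP; split=> [|i]; first exact: comps_neg_closed.
    rewrite compsE in_setU1 => /orP[/eqP->|iS].
      by rewrite Zn eqxx ffunE; case: (W n) (WS n (setU11 _ _)).
    by rewrite (negPf (ZS i iS)) ZS.
  have posW : f (comps Z W) = 0.
    apply: f0; apply/nonzero_onP; split=> [|i]; first exact: comps_closed.
    rewrite compsE in_setU1 => /orP[/eqP->|iS].
      by rewrite Zn eqxx WS ?setU11.
    by rewrite (negPf (ZS i iS)) ZS.
  move: negW posW; rewrite !fE !(deg_lt_local pP (eqZ _)) !(deg_lt_local qP (eqZ _)).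
  rewrite /lit !compsE Zn eqxx ffunE; case: (W n) (WS n (setU11 _ _)) => // b _.
  case: b; rewrite /= ?mulr1n ?mulr0n ?mul0r ?mul1r ?add0r => E1 E2.
    by rewrite E1 addr0 in E2.
  by rewrite E2 addr0 in E1.
apply: fspan_ext (fspanD rP (relations_sub (subsetUr [set n] S')
    (_ : relations M S' k.+1 (fun X => q' X + q X)))) _; last first.
  by move=> X; rewrite fE; ring.
apply: IHN => //; last first.
- move=> X /nonzero_onP[XM XS].
  have XWM : comps X W \in nonzero_on M (n |: S').
    apply/nonzero_onP; split=> [|i iS]; first exact: comps_closed.
    by rewrite compsE; case: (X i =P None) => [_|/eqP //]; apply: WS.
  have := f0 _ XWM; have := relations_vanish hM rP XWM; rewrite fE.
  have eqX : {in S', X =1 comps X W} by move=> i /XS; rewrite compsE; case: eqP.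
  rewrite (deg_lt_local q'P eqX) (deg_lt_local qP eqX) => /eqP.
  by rewrite subr_eq0 => /eqP ->.
- exact: fspanD.
- by apply/set0Pn; exists W; apply/nonzero_onP.
Qed.

End Relations.

(** * From topes to all covectors: the ideal of the zero indicators *)

Section ZeroIdeal.
Variables (K : fieldType) (I : finType).
Implicit Types (X Y Z C : sset I) (M : {set sset I}) (F S : {set I}).
Local Notation ind := (@ind K I).
Local Notation lit := (@lit K I).
Local Notation cone := (@cone K I).
Local Notation circuit_rel := (@circuit_rel K I).

Definition heaviside_gens : (sset I -> K) -> Prop :=
  fun a => exists i b, a = ind i (Some b).

Lemma ind_sum i X : ind i None X = 1 - ind i (Some true) X - ind i (Some false) X.
Proof. by rewrite /ind; case: (X i) => [[]|] /=; rewrite ?mulr1n ?mulr0n; ring. Qed.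

Lemma deg_lt_ind i s : deg_lt heaviside_gens 2 (ind i s).
Proof.
have indP b : deg_lt heaviside_gens 2 (ind i (Some b)) by apply: deg_lt_gen; exists i, b.
case: s => [b|]; first exact: indP.
by apply: fspan_ext (fspanB (fspanB (deg_lt_cst _ 1 1) (indP true)) (indP false)) _ => X;
  rewrite ind_sum.
Qed.

Lemma deg_lt_heav_lit i b : deg_lt heaviside_gens 2 (lit i b).
Proof.
case: b; first by apply: fspan_ext (deg_lt_ind i (Some true)) _ => X; rewrite ind_lit.
apply: fspan_ext (fspanB (deg_lt_cst _ 1 1) (deg_lt_ind i (Some true))) _ => X.
by rewrite ind_lit -(litN K i true).
Qed.

(** The [h_i^0] have degree one, hence weight 2.  Functions that vanish on [M] are
generators of weight 0, which makes membership depend on the values on [M]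
only. *)
Definition zero_base M S : nat -> (sset I -> K) -> Prop := fun m f =>
  (m = 2%N /\ exists2 i, i \in S & f = ind i None) \/
  (forall X, X \in M -> f X = 0).

Definition zero_ideal M S := fspan heaviside_gens (zero_base M S).

Lemma zero_ideal_ind M S i : i \in S -> zero_ideal M S 2 (ind i None).
Proof. by move=> iS; apply: (@fspan_base _ _ _ _ 2) => //; left; split=> //; exists i. Qed.

Lemma zero_ideal_null M S n f : (forall X, X \in M -> f X = 0) -> zero_ideal M S n f.
Proof. by move=> f0; apply: (@fspan_base _ _ _ _ 0) => //; right. Qed.

Lemma zero_ideal_vanish M S n f X :
  zero_ideal M S n f -> X \in nonzero_on M S -> f X = 0.
Proof.
move=> fP /nonzero_onP[XM XS]; elim: fP => {n f}.
- by move=> n f ->.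
- by move=> m n f [[_ [i iS ->]]|->] // _; rewrite /ind (negPf (XS i iS)).
- by move=> n c f g h _ f0 _ g0 ->; rewrite f0 g0 mulr0 addr0.
- by move=> n a f h _ _ f0 ->; rewrite f0 mulr0.
Qed.

Lemma zero_ideal_ext M S n f g : zero_ideal M S n f ->
  (forall X, X \in M -> g X = f X) -> zero_ideal M S n g.
Proof.
move=> fP gf; apply: (fspan_lin (c := 1) fP) (_ : _ =1 _); last first.
  by move=> X; rewrite mul1r addrC; apply: (esym (subrK (f X) (g X))).
by apply: zero_ideal_null => X XM; rewrite gf ?subrr.
Qed.

(** Expand each factor [1 - y_i] as [h_i^- + h_i^0]: the term without any [h_i^0]
is the indicator of the covectors that extend [C], which is zero on [M], and
every other term contains some [h_i^0]. *)
Lemma zero_ideal_cone M S C : supp C \subset S -> unrealized M C ->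
  zero_ideal M S #|supp C|.+1 (cone C).
Proof.
move=> CS nC.
(* The factors are replaced one at a time along a list of elements of C. *)
pose hs (r : seq I) X := \prod_(i <- r) ind i (C i) X.
have diffP (r : seq I) : {subset r <= supp C} -> zero_ideal M S (size r).+1
    (fun X => \prod_(i <- r) lit i (C i == Some true) X - hs r X).
  elim: r => [|i r IHr] rC.
    by apply: fspan0 => X; rewrite /hs !big_nil subrr.
  have iC : i \in supp C by apply/rC/mem_head.
  have{IHr} IHr : zero_ideal M S (size r).+1 (fun X =>
      \prod_(i <- r) lit i (C i == Some true) X - hs r X).
    by apply: IHr => j jr; apply: rC; rewrite inE jr orbT.
  have hsP : deg_lt heaviside_gens (size r).+1 (hs r).
    by apply: deg_lt_prod => j; apply: deg_lt_ind.
  have i0 := zero_ideal_ind M (subsetP CS i iC).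
  have h0P := fspan_mul hsP i0; rewrite addSn addn2 /= in h0P.
  have mP := fspan_mul (deg_lt_heav_lit i (C i == Some true)) IHr.
  apply: (fspan_lin (c := (C i == Some false)%:R) h0P mP) => X.
  rewrite /hs !big_cons /= -/(hs r X) /lit /ind.
  rewrite suppE in iC; move: iC; case: (C i) => [[]|] //= _;
    case: (X i) => [[]|] /=; rewrite ?mulr1n ?mulr0n; ring.
have := diffP (enum (supp C)); rewrite -cardE => H.
apply: zero_ideal_ext (H _) _ => [i|X XM]; first by rewrite mem_enum.
rewrite big_enum /= -/(cone C X) /hs big_enum /=.
have := nC X XM; rewrite /ind prod_bool /extends => /negPf ->.
by rewrite subr0.
Qed.

Section Minimal.
Variables (M : {set sset I}) (S : {set I}) (C : sset I).
Hypotheses (hM : is_COM M) (MS : nonzero_on M S != set0).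
Hypotheses (CS : supp C \subset S) (nonC : unrealized M C) (cC : centered M C).
Hypothesis (minC : forall b, b \in supp C ->
  exists2 Y, Y \in M & extends (upd C b None) Y).

(** If [C] is minimal among the partial sign vectors that no covector extends, then
a covector whose entries on the support of [C] are all zero or equal to those
of [C] must vanish there: composing it with a covector that agrees with [C]
except at one of its nonzero positions would extend [C]. *)
Lemma min_conform X : X \in M ->
  (forall i, i \in supp C -> X i != None -> X i = C i) ->
  forall d, d \in supp C -> X d = None.
Proof.
move=> XM XC d dC; apply/eqP; apply: contraT => Xd.
have [Y YM /extendsP YC] := minC dC.
have /negP[] := nonC (comps_closed hM XM YM); apply/extendsP=> i iC.
rewrite compsE; case: (X i =P None) => [Xi|/eqP]; last exact: XC.
have id' : i != d by apply: contraNneq Xd => <-; apply/eqP.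
by rewrite YC ?ffunE ?(negPf id') //; rewrite suppE ffunE (negPf id') -suppE.
Qed.

(** A covector that is zero on the support of [C] turns [-X] into a covector, up to
entries outside that support. *)
Lemma min_conform_neg X : X \in M ->
  (forall i, i \in supp C -> X i != None -> X i = negs C i) ->
  forall d, d \in supp C -> X d = None.
Proof.
case: cC => Z ZM Z0 XM XC d dC.
have ZX i : i \in supp C -> comps Z (negs X) i = sopp (X i).
  by move=> iC; rewrite compsE Z0 // eqxx ffunE.
suff: comps Z (negs X) d = None by rewrite ZX //; case: (X d).
apply: min_conform dC => [|i iC]; first exact: comps_neg_closed.
rewrite ZX // => Xi; rewrite XC ?ffunE ?soppK //.
by case: (X i) Xi.
Qed.

Lemma min_circuit_eq0 X d : X \in M -> d \in supp C -> X d != None -> circuit_rel C X = 0.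
Proof.
move=> XM dC Xd; rewrite /circuit_rel.
have -> : cone C X = 0.
  rewrite /cone prod_bool; case: forall_inP => // XC.
  case/eqP: Xd; apply: min_conform dC => // i iC Xi.
  have := XC i iC; rewrite suppE in iC.
  by case: (X i) (C i) Xi iC => [[]|] [[]|].
have -> : cone (negs C) X = 0.
  rewrite /cone prod_bool supp_negs; case: forall_inP => // XC.
  case/eqP: Xd; apply: min_conform_neg dC => // i iC Xi.
  have := XC i iC; rewrite suppE in iC; rewrite ffunE.
  by case: (X i) (C i) Xi iC => [[]|] [[]|].
by rewrite mulr0 subrr.
Qed.

(** On [M] the relation is constant where the support of [C] is contained in the
flat and zero elsewhere.  By minimality, a covector that is zero on all of the
support except [d] is zero at [d] too; hence that indicator is a product with
one factor less than the size of the support. *)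
Lemma zero_ideal_min_circuit : zero_ideal M S #|supp C| (circuit_rel C).
Proof.
have [W /nonzero_onP[WM WS]] := set0Pn _ MS.
(* The support has two elements at least, since a tope is nonzero on it. *)
have two_elements : exists2 d, d \in supp C & exists2 e, e \in supp C & e != d.
  have CW : supp C != set0.
    apply: contraT; rewrite negbK => /eqP C0.
    by have /negP[] := nonC WM; apply/extendsP=> i; rewrite C0 inE.
  case/set0Pn: CW => d dC; exists d => //; apply/exists_inP; apply: contraT.
  rewrite negb_exists_in => /forall_inP only.
  have Wd := WS d (subsetP CS d dC).
  have conf (D : sset I) : supp D = supp C -> W d = D d ->
      forall i, i \in supp C -> W i != None -> W i = D i.
    by move=> _ WD i /only; rewrite negbK => /eqP ->.
  have [Wp|Wm] : W d = C d \/ W d = negs C d.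
  - by move: dC Wd; rewrite suppE ffunE; case: (W d) (C d) => [[]|] [[]|] //; tauto.
  - by rewrite (min_conform WM (conf C erefl Wp) dC) in Wd.
  - by rewrite (min_conform_neg WM (conf _ (supp_negs C) Wm) dC) in Wd.
have [d dC [e eC ed]] := two_elements.
pose zero : sset I := [ffun=> None].
have prodE X : X \in M ->
    circuit_rel C X = circuit_rel C zero * \prod_(i in supp C :\ d) ind i None X.
  move=> XM; rewrite /ind prod_bool; case: forall_inP => [X0|/forall_inP].
    have Xd : X d = None.
      apply/eqP; apply: contraT => Xd.
      have XCd i : i \in supp C -> X i != None -> i = d.
        move=> iC Xi; apply/eqP; apply: contraT => id'.
        by rewrite X0 // in Xi; apply/setD1P.
      have [Xp|Xm] : X d = C d \/ X d = negs C d.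
      - by move: dC Xd; rewrite suppE ffunE; case: (X d) (C d) => [[]|] [[]|] //; tauto.
      - by case/eqP: (Xd); apply: min_conform dC => // i iC /(XCd i iC) ->.
      - by case/eqP: (Xd); apply: min_conform_neg dC => // i iC /(XCd i iC) ->.
    rewrite mulr1.
    have eqX (i : I) : i \in supp C -> X i = zero i.
      move=> iC; rewrite ffunE; have [-> //|id'] := eqVneq i d.
      by apply/eqP/X0/setD1P.
    rewrite /circuit_rel /cone supp_negs; congr (_ - _ * _);
      by apply: eq_bigr => i iC; rewrite /lit eqX.
  rewrite negb_forall_in => /exists_inP[i /setD1P[_ iC] Xi].
  by rewrite mulr0 (min_circuit_eq0 XM iC).
apply: zero_ideal_ext (fspanZ (circuit_rel C zero) (_ : fspan _ _ _
  (fun X => \prod_(i in supp C :\ d) ind i None X))) _; last exact: prodE.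
have eCd : e \in supp C :\ d by apply/setD1P.
have P := deg_lt_prod_set (A := supp C :\ d :\ e) (fun i _ => deg_lt_ind i None).
apply: fspan_ext (fspan_mono (fspan_mul P (zero_ideal_ind M (subsetP CS e eC))) _) _.
  by rewrite (cardsD1 d (supp C)) dC (cardsD1 e (supp C :\ d)) eCd; lia.
by move=> X; rewrite (big_setD1 e eCd) /= mulrC.
Qed.

End Minimal.

(** When removing [b] leaves an unrealized [C'], [circuit_upd] writes the relation
of [C] as a literal times that of [C'] plus a multiple of [cone (negs C')], and
induction applies. *)
Lemma zero_ideal_circuit M S C : is_COM M -> nonzero_on M S != set0 ->
    supp C \subset S -> unrealized M C -> centered M C ->
  zero_ideal M S #|supp C| (circuit_rel C).
Proof.
move=> hM MS; have [k] := ubnP #|supp C|; elim: k C => // k IHk C Ck CS nonC cC.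
have [|min] := boolP [exists b in supp C,
    [forall X in M, ~~ extends (upd C b None) X]]; last first.
  apply: zero_ideal_min_circuit => // b bC; apply/exists_inP.
  apply: contraNT min; rewrite negb_exists_in => none.
  by apply/exists_inP; exists b.
case/exists_inP=> b bC /forall_inP nonC'.
set C' := upd C b None in nonC'.
have bC' : b \notin supp C' by rewrite suppE ffunE eqxx.
have [s Cb] : exists s, C b = Some s.
  by move: bC; rewrite suppE; case: (C b) => // s _; exists s.
have CE : C = upd C' b (Some s).
  by apply/ffunP=> i; rewrite !ffunE; case: (i =P b) => // ->.
have suppC : supp C = b |: supp C' by rewrite CE supp_upd.
have C'S : supp C' \subset S.
  by apply: subset_trans CS; rewrite suppC subsetUr.
have cC' : centered M C' by apply: centered_supp cC; rewrite suppC subsetUr.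
have cardC : #|supp C| = #|supp C'|.+1 by rewrite suppC cardsU1 bC'.
have IH : zero_ideal M S #|supp C'| (circuit_rel C').
  by apply: IHk => //; rewrite -ltnS -cardC.
have hP := zero_ideal_cone (C := negs C') (M := M) (S := S).
rewrite supp_negs in hP.
have {}hP := hP C'S (unrealized_negs hM cC' nonC').
have cP := fspan_mul (deg_lt_heav_lit b s) IH.
rewrite cardC CE; apply: (fspan_lin (c := (-1) ^+ #|supp C'|) hP cP) => X.
by rewrite circuit_upd // addrC.
Qed.

Lemma heav_of_plus S (a : sset I -> K) : plus_gens S a -> deg_lt heaviside_gens 2 a.
Proof. by case=> i _ ->; apply: deg_lt_ind. Qed.

Lemma relations_zero_ideal M S n f : is_COM M -> nonzero_on M S != set0 ->
  relations M S n f -> zero_ideal M S n f.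
Proof.
move=> hM MS fP.
have := @fspan_transfer _ _ _ id (fun=> 1) 0 _ _ heaviside_gens (zero_base M S) _ _ n f fP.
rewrite addn0 => H; apply: fspan_ext (H _ _) _ => [a|m g|X]; last by rewrite mul1r.
  exact: heav_of_plus.
case=> C [CS nonC gE]; rewrite addn0.
apply: (@fspan_ext _ _ _ _ _ g) => [|X]; last by rewrite mul1r.
case: gE => [[-> ->]|[cC -> ->]]; first exact: zero_ideal_cone.
exact: zero_ideal_circuit.
Qed.

(** Modulo the [h_i^0], [h_i^-] is [1 - y_i], so every polynomial in the Heaviside
functions reduces to one in the [y_i] of the same degree. *)
Lemma deg_lt_plus_approx M S n f :
    (forall X, X \in M -> forall i, i \notin S -> X i = None) ->
    deg_lt heaviside_gens n f ->
  exists2 g, deg_lt (plus_gens S) n g & zero_ideal M S n (fun X => f X - g X).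
Proof.
move=> MS; elim=> {n f}.
- move=> n f f0; exists (fun=> 0); first exact: fspan0.
  by apply: fspan0 => X; rewrite f0 subrr.
- move=> m n f [-> f1] n_gt0; exists (fun=> 1).
    by apply: fspan_mono (deg_lt_cst _ 0 1) _.
  by apply: fspan0 => X; rewrite f1 subrr.
- move=> n c f g h _ [f' f'P fP] _ [g' g'P gP] hE.
  exists (fun X => c * f' X + g' X); first exact: fspan_lin f'P g'P _.
  by apply: (fspan_lin (c := c) fP gP) => X; rewrite hE; ring.
- move=> n a f h [i [b ->]] _ [f' f'P fP] hE.
  have [iS|iS] := boolP (i \in S); last first.
    exists (fun=> 0); first exact: fspan0.
    apply: zero_ideal_null => X XM.
    by rewrite hE /ind MS // mul0r subrr.
  exists (fun X => lit i b X * f' X).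
    exact: (fspan_mul (deg_lt_lit _ _ iS) f'P).
  have f'H : deg_lt heaviside_gens n f'.
    by apply: deg_lt_pull f'P => a'; apply: heav_of_plus.
  have zP := fspan_mul f'H (zero_ideal_ind M iS).
  case: (posnP n) => [n0|n_gt0].
    subst n; apply: fspan_ext (fspan_mul (deg_lt_ind i (Some b)) fP) _ => X.
    by rewrite hE (deg_lt0 f'P); ring.
  have -> : n.+1 = (n + 2).-1 by lia.
  have fP' := fspan_mul (deg_lt_ind i (Some b)) fP.
  rewrite addnC in fP'.
  apply: (fspan_lin (c := - (~~ b)%:R) zP fP') => X.
  rewrite hE /lit /ind; case: b {hE fP'}; case: (X i) => [[]|] /=;
    rewrite ?mulr1n ?mulr0n; ring.
Qed.

Theorem vanishing_zero_ideal M S n f : is_COM M -> nonzero_on M S != set0 ->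
    (forall X, X \in M -> forall i, i \notin S -> X i = None) ->
    deg_lt heaviside_gens n f -> (forall X, X \in nonzero_on M S -> f X = 0) ->
  zero_ideal M S n f.
Proof.
move=> hM MS offS fP f0; have [g gP fgP] := deg_lt_plus_approx offS fP.
have gz : zero_ideal M S n g.
  apply: relations_zero_ideal => //; apply: vanishing_relations => // X XMS.
  by have := zero_ideal_vanish fgP XMS; rewrite f0 // sub0r => /eqP; rewrite oppr_eq0 => /eqP.
by apply: fspan_ext (fspanD fgP gz) _ => X; ring.
Qed.

End ZeroIdeal.

(** * Codimension of flats *)

Section Codim.
Variable I : finType.
Implicit Types (X Y Z : sset I) (M : {set sset I}) (A B F G : {set I}).

Lemma Flat_comps X Y : Flat (comps X Y) = Flat X :&: Flat Y.
Proof. by apply/setP=> i; rewrite !inE compsE; case: (X i). Qed.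

Lemma flatsI M F G : is_COM M -> F \in flats M -> G \in flats M -> F :&: G \in flats M.
Proof.
move=> hM /imsetP[X XM ->] /imsetP[Y YM ->]; rewrite -Flat_comps.
exact/imset_f/comps_closed.
Qed.

(** [x] lies in the closure of [A]; stated without the closure, which exists only
for subsets of some flat. *)
Definition dep M A x := [forall G in flats M, (A \subset G) ==> (x \in G)].

Lemma depP M A x :
  reflect (forall G, G \in flats M -> A \subset G -> x \in G) (dep M A x).
Proof.
apply: (iffP forall_inP) => H G GM; first exact/implyP/H.
by apply/implyP/H.
Qed.

Lemma depS M A A' x : A \subset A' -> dep M A x -> dep M A' x.
Proof. by move=> AA' /depP Ax; apply/depP=> G GM /(subset_trans AA'); apply: Ax. Qed.

(** A flat with [A] and [y] but not [x] would come from a covector [W] with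
[W x <> 0].  Composing a covector with flat [F] with plus or minus one that
detects [y] gives [X'] with the sign at [x] opposite to [W], nonzero at [y] and
zero on [A]; eliminating [x] contradicts the dependence of [y] on [A] and
[x]. *)
Lemma dep_exchange M F A x y : is_COM M -> F \in flats M -> x |: A \subset F ->
  dep M (x |: A) y -> ~~ dep M A y -> dep M (y |: A) x.
Proof.
move=> hM FM xAF /depP xAy /forall_inPn[_ /imsetP[X XM ->]].
rewrite negb_imply inE => /andP[AX Xy].
have yF := xAy F FM xAF.
case/imsetP: FM xAF yF => Z ZM -> xAZ; rewrite inE => /eqP Zy.
apply/depP=> _ /imsetP[W WM ->] yAW; rewrite inE; apply: contraT.
have zeroA T : A \subset Flat T -> forall i, i \in A -> T i = None.
  by move=> /subsetP AT i /AT; rewrite inE => /eqP.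
move: xAZ yAW; rewrite !subUset !sub1set !inE => /andP[/eqP Zx AZ] /andP[/eqP Wy AW].
have Xx : X x != None.
  apply: contra Xy => Xx; have := xAy (Flat X) (imset_f _ XM).
  by rewrite inE; apply; rewrite subUset sub1set inE Xx.
case Wx : (W x) => [w|] // _.
have [X' [X'M X'x X'y X'A]] : exists X', [/\ X' \in M, X' x = Some (~~ w),
    X' y != None & forall i, i \in A -> X' i = None].
  have [Xw|Xw] := boolP (X x == Some w).
    exists (comps Z (negs X)); split.
    - exact: comps_neg_closed.
    - by rewrite compsE Zx eqxx ffunE (eqP Xw).
    - by rewrite compsE Zy eqxx ffunE; case: (X y) Xy.
    - by move=> i iA; rewrite compsE (zeroA _ AZ) // eqxx ffunE (zeroA _ AX).
  exists (comps Z X); split.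
  - exact: comps_closed.
  - by rewrite compsE Zx eqxx; case: (X x) Xx Xw => [[]|] //; case: (w).
  - by rewrite compsE Zy eqxx.
  - by move=> i iA; rewrite compsE (zeroA _ AZ) // eqxx (zeroA _ AX).
have [|V [VM Vx VE]] := eliminate hM X'M WM X'x; first by rewrite Wx negbK.
have := xAy (Flat V) (imset_f _ VM); rewrite inE VE; last by rewrite Wy X'y orbT.
rewrite compsE (negPf X'y) => /(_ _)/negPn; rewrite X'y; apply.
rewrite subUset sub1set inE Vx eqxx; apply/subsetP=> i iA.
by rewrite inE VE ?X'A ?eqxx // compsE X'A // eqxx (zeroA _ AW).
Qed.

Definition spans M A F :=
  [&& F \in flats M, A \subset F & [forall x in F, dep M A x]].

Lemma spansP M A F :
  reflect [/\ F \in flats M, A \subset F &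
    forall G, G \in flats M -> A \subset G -> F \subset G] (spans M A F).
Proof.
apply: (iffP and3P) => -[FM AF H]; split=> //.
  by move=> G GM AG; apply/subsetP=> x xF; apply: (depP _ _ _ (forall_inP H x xF)).
by apply/forall_inP=> x xF; apply/depP=> G GM /(H G GM)/subsetP; apply.
Qed.

Lemma is_closure_spans M A F : is_COM M -> is_closure M A F = spans M A F.
Proof.
move=> hM; apply/minsetP/spansP => [[/andP[FM AF] Fmin]|[FM AF Fmin]].
  split=> // G GM AG; rewrite -(Fmin (F :&: G)) ?subsetIr ?subsetIl //.
  by rewrite flatsI //= subsetI AF.
split=> [|G /andP[GM AG] GF]; first by rewrite FM.
by apply/eqP; rewrite eqEsubset GF Fmin.
Qed.

Lemma basicP M F B : is_COM M ->
  reflect (spans M B F /\ forall b, b \in B -> ~~ dep M (B :\ b) b) (basic M F B).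
Proof.
move=> hM; rewrite /basic is_closure_spans //.
apply: (iffP and3P) => [[BF Bsp /forallP Bmin]|[Bsp Bind]].
  split=> // b bB; apply/negP=> /depP bdep.
  have := Bmin (B :\ b); rewrite is_closure_spans // subD1set /=.
  suff -> : spans M (B :\ b) F.
    by move=> /eqP E; move: bB; rewrite -E !inE eqxx.
  have [FM _ FB] := spansP _ _ _ Bsp.
  apply/spansP; split=> // [|G GM BG].
    by apply: subset_trans BF; apply: subD1set.
  by apply: FB => //; rewrite -(setD1K bB) subUset sub1set bdep.
have [FM BF FB] := spansP _ _ _ Bsp; split=> //.
apply/forallP=> C; apply/implyP=> /andP[CB]; rewrite is_closure_spans //.
case/spansP=> _ CF FC; rewrite eqEsubset CB; apply/subsetP=> b bB.
apply: contraT => bC; case/negP: (Bind b bB).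
apply/depP=> G GM BG; apply: (subsetP (FC G GM _)); last exact: (subsetP BF).
by apply: subset_trans BG; rewrite subsetD1 CB.
Qed.

(** Steinitz exchange: an element of [B] outside [A] can be replaced by one of [A]
without losing independence, which makes [B :\: A] smaller. *)
Lemma indep_card M A B F : is_COM M -> spans M A F -> B \subset F ->
  (forall b, b \in B -> ~~ dep M (B :\ b) b) -> (#|B| <= #|A|)%N.
Proof.
move=> hM Asp; have [FM AF FA] := spansP _ _ _ Asp.
have [k] := ubnP #|B :\: A|; elim: k B => // k IHk B Bk BF Bind.
have [|/subsetPn[b bB bA]] := boolP (B \subset A); first exact: subset_leq_card.
have [a aA aB] : exists2 a, a \in A & ~~ dep M (B :\ b) a.
  apply/exists_inP; rewrite -negb_forall_in; apply/negP=> /forall_inP AB.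
  have /negP[] := Bind b bB; apply/depP=> G GM BG.
  apply: (subsetP (FA G GM _)); last exact: (subsetP BF).
  by apply/subsetP=> a /AB/depP; apply.
have aB' : a \notin B :\ b.
  by apply: contra aB => aB; apply/depP=> G _ /subsetP; apply.
have <- : #|a |: (B :\ b)| = #|B| by rewrite cardsU1 aB' (cardsD1 b B) bB.
apply: IHk.
- rewrite -ltnS; apply: leq_trans Bk; rewrite ltnS.
  rewrite (cardsD1 b (B :\: A)) !inE bA bB ltnS; apply: subset_leq_card.
  apply/subsetP=> x; rewrite !inE => /andP[xA /orP[/eqP xa|/andP[xb xB]]].
    by rewrite xa aA in xA.
  by rewrite xb xA.
- rewrite subUset sub1set (subsetP AF) //=.
  by apply: subset_trans BF; apply: subD1set.
move=> x /setU1P[->|xB]; first by rewrite setU1K.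
have [xb xB0] := setD1P xB.
have xa : x != a by apply: contraNneq aB' => <-.
have -> : (a |: B :\ b) :\ x = a |: (B :\ b :\ x).
  apply/setP=> y; rewrite !inE; case: (y =P a) => [->|//] /=.
  by rewrite eq_sym xa.
apply: contra aB => xdep; rewrite -(setD1K xB).
apply: dep_exchange hM FM _ xdep _.
  rewrite subUset sub1set (subsetP AF) //=.
  by apply: subset_trans BF; rewrite !subDset; apply: subset_trans (subsetUr _ _); apply: subsetUr.
apply: contra (Bind x xB0); apply: depS; apply: setSD; exact: subD1set.
Qed.

Lemma spans_refl M F : F \in flats M -> spans M F F.
Proof. by move=> FM; apply/spansP; split. Qed.

Lemma basic_exists M F : is_COM M -> F \in flats M -> exists B, basic M F B.
Proof.
move=> hM FM; have [B] := minset_exists (spans_refl FM) (P := fun B => spans M B F).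
move=> /minsetP[Bsp Bmin] BF; exists B; rewrite /basic BF is_closure_spans // Bsp.
apply/forallP=> C; apply/implyP=> /andP[CB]; rewrite is_closure_spans // => Csp.
by apply/eqP/Bmin.
Qed.

Lemma codim_basis M F : is_COM M -> F \in flats M ->
  exists2 B, spans M B F & #|B| = codim M F.
Proof.
move=> hM FM; rewrite /codim; case: pickP => [B /(basicP _ _ hM)[Bsp _]|none].
  by exists B.
by have [B] := basic_exists hM FM; rewrite none.
Qed.

Lemma codim_le M A F : is_COM M -> spans M A F -> (codim M F <= #|A|)%N.
Proof.
move=> hM Asp; rewrite /codim; case: pickP => // B /(basicP _ _ hM)[Bsp Bind].
by apply: indep_card Asp _ Bind; [exact: hM | case/and3P: Bsp].
Qed.

Lemma codim_setU1 M F G i : is_COM M -> F \in flats M -> spans M (i |: F) G ->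
  (codim M G <= (codim M F).+1)%N.
Proof.
move=> hM FM /spansP[GM iFG Gmin].
have [B /spansP[_ BF FB] <-] := codim_basis hM FM.
apply: leq_trans (codim_le (A := i |: B) hM _) _; last first.
  by rewrite cardsU1; case: (_ \notin _).
apply/spansP; split=> // [|H HM].
  by apply: subset_trans iFG; apply: setUS.
rewrite subUset => /andP[iH BH]; apply: Gmin => //.
by rewrite subUset iH FB.
Qed.

Lemma spans_exists M A F : is_COM M -> F \in flats M -> A \subset F ->
  exists G, spans M A G.
Proof.
move=> hM FM AF.
have [|G GA _] := @minset_exists _ (fun G => (G \in flats M) && (A \subset G)) F.
  by rewrite FM.
by exists G; rewrite -is_closure_spans.
Qed.

End Codim.

(** * Decomposition of the big ring along flats *)

Section Decomposition.
Variables (K : fieldType) (I : finType) (M : {set sset I}).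
Hypothesis hM : is_COM M.
Implicit Types (X Y Z : sset I) (F G : {set I}) (U : {set {set I}}).
Local Notation ind := (@ind K I).
Local Notation heav := (@heaviside_gens K I).

Definition flat_ind F : sset I -> K := fun X => (F \subset Flat X)%:R.

(** The functions [h_F] for the flats outside [U], in degree [codim F]; as in
[zero_base], functions that vanish on [M] come for free. *)
Definition flat_span_base U : nat -> (sset I -> K) -> Prop := fun m f =>
  (exists F, [/\ F \in flats M, F \notin U, m = (codim M F).+1 & f = flat_ind F])
  \/ (forall X, X \in M -> f X = 0).

Definition flat_span U := fspan heav (flat_span_base U).

Lemma flat_span_null U n f : (forall X, X \in M -> f X = 0) -> flat_span U n f.
Proof. by move=> f0; apply: (@fspan_base _ _ _ _ 0) => //; right. Qed.

Lemma flat_span_ext U n f g : flat_span U n f ->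
  (forall X, X \in M -> g X = f X) -> flat_span U n g.
Proof.
move=> fP gf; apply: (fspan_lin (c := 1) fP) (_ : _ =1 _); last first.
  by move=> X; rewrite mul1r addrC; apply: (esym (subrK (f X) (g X))).
by apply: flat_span_null => X XM; rewrite gf ?subrr.
Qed.

Lemma flat_span_flat_ind U F : F \in flats M -> F \notin U ->
  flat_span U (codim M F).+1 (flat_ind F).
Proof.
move=> FM FU; apply: (@fspan_base _ _ _ _ (codim M F).+1) => //.
by left; exists F.
Qed.

Definition downset U :=
  forall F G, F \in flats M -> G \in U -> F \subset G -> F \in U.

(** No flat outside a down-set is contained in a flat inside it. *)
Lemma flat_span_vanish U n f X : downset U -> flat_span U n f ->
  X \in M -> Flat X \in U -> f X = 0.
Proof.
move=> dU fP XM XU; elim: fP => {n f}.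
- by move=> n f ->.
- move=> m n f [[F [FM FU _ ->]]|->] // _.
  by rewrite /flat_ind; case: (boolP (F \subset _)) => // /(dU _ _ FM XU); rewrite (negPf FU).
- by move=> n c f g h _ f0 _ g0 ->; rewrite f0 g0 mulr0 addr0.
- by move=> n a f h _ _ f0 ->; rewrite f0 mulr0.
Qed.

Lemma flat_span_split U G n f : flat_span U n f ->
  exists p r, [/\ deg_lt heav (n - codim M G) p, flat_span (G |: U) n r &
    forall X, f X = flat_ind G X * p X + r X].
Proof.
elim=> {n f}.
- move=> n f f0; exists (fun=> 0), (fun=> 0); split; try exact: fspan0.
  by move=> X; rewrite f0 mulr0 addr0.
- move=> m n f fB mn.
  have [[-> mE]|fB'] : (f = flat_ind G /\ m = (codim M G).+1) \/ flat_span_base (G |: U) m f.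
    case: fB => [[F [FM FU mE fE]]|f0]; last by right; right.
    have [<-|FG] := eqVneq F G; first by left.
    by right; left; exists F; split=> //; rewrite in_setU1 (negPf FG).
    exists (fun=> 1), (fun=> 0); split; [|exact: fspan0|].
      by apply: fspan_mono (deg_lt_cst _ 0 1) _; rewrite subn_gt0 -mE.
    by move=> X; rewrite mulr1 addr0.
  exists (fun=> 0), f; split; [exact: fspan0 | exact: fspan_base fB' mn |].
  by move=> X; rewrite mulr0 add0r.
- move=> n c f g h _ [p [q [pP qP fE]]] _ [p' [q' [p'P q'P gE]]] hE.
  exists (fun X => c * p X + p' X), (fun X => c * q X + q' X).
  split; [exact: fspan_lin pP p'P _ | exact: fspan_lin qP q'P _ |].
  by move=> X; rewrite hE fE gE; ring.
- move=> n a f h Ga _ [p [r [pP rP fE]]] hE.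
  exists (fun X => a X * p X), (fun X => a X * r X); split.
  + have [cn|nc] := leqP (codim M G) n; first by rewrite subSn //; exact: fspan_gen Ga pP _.
    have n0 : (n - codim M G = 0)%N by apply/eqP; rewrite subn_eq0 ltnW.
    rewrite n0 in pP; apply: fspan0 => X; by rewrite (deg_lt0 pP) mulr0.
  + exact: fspan_gen Ga rP _.
  + by move=> X; rewrite hE fE; ring.
Qed.

Lemma flat_ind_setU1 F i X : flat_ind (i |: F) X = flat_ind F X * ind i None X.
Proof.
rewrite /flat_ind /ind subUset sub1set inE andbC.
by case: (_ \subset _); case: (_ == _); rewrite /= ?mulr1n ?mulr0n; ring.
Qed.

Lemma flat_ind_spans A F X : spans M A F -> X \in M -> flat_ind F X = flat_ind A X.
Proof.
case/spansP=> FM AF Amin XM; rewrite /flat_ind; congr (nat_of_bool _)%:R.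
apply/idP/idP; first exact: subset_trans.
exact/Amin/imset_f.
Qed.

Lemma mem_face_topes G X : X \in M ->
  (X \in nonzero_on (face_at M G) (~: G)) = (Flat X == G).
Proof.
move=> XM; rewrite !inE XM eqEsubset /= andbC; congr andb.
apply/forall_inP/subsetP=> [H i|H i]; rewrite !inE.
  by apply: contraLR => iG; apply: H; rewrite inE.
by apply: contra => /eqP Xi; apply: H; rewrite inE Xi.
Qed.

(** On [M], [h_G h_i^0] is [h_F] for the closure [F] of [G] and [i], or zero if
there is no such flat; and the codimension grows by one at most. *)
Lemma flat_ind_mul_zero_ideal U G n f : G \in flats M -> G \notin U -> downset U ->
    zero_ideal (face_at M G) (~: G) n f ->
  flat_span (G |: U) (n + codim M G) (fun X => flat_ind G X * f X).
Proof.
move=> GM GU dU.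
apply: (@fspan_transfer _ _ _ id) => [a [i [b ->]]|m {}f].
  exact: deg_lt_ind.
case=> [[-> [i iG ->]]|f0]; last first.
  apply: flat_span_null => X XM; rewrite /flat_ind.
  case: (boolP (G \subset _)) => [GX|_]; last by rewrite mul0r.
  by rewrite f0 ?mulr0 // inE XM.
have [|] := boolP [exists H in flats M, i |: G \subset H]; last first.
  rewrite negb_exists_in => /forall_inP none.
  apply: flat_span_null => X XM; rewrite -flat_ind_setU1 /flat_ind.
  by rewrite (negPf (none _ (imset_f _ XM))).
case/exists_inP=> H HM iGH.
have [F Fsp] := spans_exists hM HM iGH.
have [FM iGF _] := spansP _ _ _ Fsp.
apply: flat_span_ext (fspan_mono (flat_span_flat_ind FM _) _) _; last first.
- by move=> X XM; rewrite (flat_ind_spans Fsp XM) flat_ind_setU1.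
- by rewrite add2n ltnS; apply: codim_setU1 Fsp.
rewrite inE in iG; rewrite in_setU1 negb_or; apply/andP; split.
  by apply: contraNneq iG => <-; apply: (subsetP iGF); apply: setU11.
apply: contra GU => FU; apply: dU FU _ => //.
by apply: subset_trans iGF; apply: subsetUr.
Qed.

(** At covectors with flat [G] only the coefficient of [h_G] contributes, so it
vanishes on the topes of the contraction at [G] and lies in its zero ideal. *)
Lemma flat_span_step U G n f : G \in flats M -> G \notin U -> downset U ->
    downset (G |: U) -> flat_span U n f ->
    (forall X, X \in M -> Flat X = G -> f X = 0) ->
  flat_span (G |: U) n f.
Proof.
move=> GM GU dU dGU fP f0.
have [p [r [pP rP fE]]] := flat_span_split G fP.
apply: fspan_ext (fspanD (_ : flat_span (G |: U) n (fun X => flat_ind G X * p X)) rP) _ => //.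
have [nc|cn] := ltnP n (codim M G).
  rewrite (eqP (ltnW nc : (n - codim M G)%N == 0%N)) in pP.
  by apply: fspan0 => X; rewrite (deg_lt0 pP) mulr0.
rewrite -(subnK cn); apply: flat_ind_mul_zero_ideal => //.
apply: vanishing_zero_ideal => //; first exact: face_at_COM.
- case/imsetP: GM => X XM ->; apply/set0Pn; exists X.
  by rewrite mem_face_topes.
- by move=> X /face_atP[_ X0] i; rewrite inE negbK => /X0.
move=> X XG; have XM : X \in M by case/nonzero_onP: XG => /face_atP[].
rewrite mem_face_topes // in XG; have /esym := fE X.
rewrite f0 //; last exact/eqP.
rewrite (flat_span_vanish dGU rP) // ?(eqP XG) ?setU11 // addr0 /flat_ind (eqP XG).
by rewrite subxx mul1r.
Qed.

Lemma downset_maximal U : U != set0 -> downset U ->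
  exists2 G, G \in U & downset (U :\ G).
Proof.
case/set0Pn=> G0 G0U dU.
have [G GU Gmax] := @arg_maxnP _ G0 (mem U) (fun G => #|G|) G0U.
exists G => // F H FM /setD1P[HG HU] FH.
rewrite in_setD1 (dU _ _ FM HU FH) andbT.
apply: contraNneq HG => FG; rewrite eq_sym eqEcard -FG FH /=.
by rewrite FG; apply: Gmax.
Qed.

(** The unit is [h_F] for the least flat [F], whose codimension is zero. *)
Lemma flat_span_all n f : deg_lt heav n f -> flat_span set0 n f.
Proof.
move=> fP; have [M0|/set0Pn[X0 X0M]] := eqVneq M set0.
  by apply: flat_span_null => X; rewrite M0 inE.
have [X XM Xmin] := @arg_minnP _ X0 (mem M) (fun X => #|Flat X|) X0M.
have least Y : Y \in M -> Flat X \subset Flat Y.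
  move=> YM; have := Xmin _ (comps_closed hM XM YM); rewrite Flat_comps => le.
  apply/setIidPl/eqP; rewrite eqEcard subsetIl; exact: le.
have FM : Flat X \in flats M by apply: imset_f.
have /eqP c0 : codim M (Flat X) == 0%N.
  rewrite -leqn0 -(@cards0 I); apply: codim_le => //; apply/spansP.
  by split=> //; [exact: sub0set | move=> _ /imsetP[Y YM ->] _; apply: least].
have oneP : flat_span set0 1 (flat_ind (Flat X)).
  by rewrite -{1}c0; apply: flat_span_flat_ind; rewrite ?inE.
have := fspan_mul fP oneP; rewrite addn1 => fP'.
by apply: flat_span_ext fP' _ => Y YM; rewrite /flat_ind least // mulr1.
Qed.

Lemma vanishing_flat_span U n f : U \subset flats M -> downset U -> deg_lt heav n f ->
    (forall X, X \in M -> Flat X \in U -> f X = 0) ->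
  flat_span U n f.
Proof.
have [k] := ubnP #|U|; elim: k U => // k IHk U Uk UM dU fP f0.
have [->|U0] := eqVneq U set0; first exact: flat_span_all.
have [G GU dU'] := downset_maximal U0 dU.
rewrite (cardsD1 G U) GU in Uk.
rewrite -(setD1K GU); apply: flat_span_step => //.
- exact: (subsetP UM).
- by rewrite !inE eqxx.
- by rewrite setD1K.
- apply: IHk => // [|X XM /setD1P[_]]; last exact: f0.
  by apply: subset_trans UM; apply: subD1set.
- by move=> X XM XG; apply: f0 => //; rewrite XG.
Qed.

Theorem restrict_flat U G n f : U \subset flats M -> downset U -> downset (G |: U) ->
    deg_lt heav n f -> (forall X, X \in M -> Flat X \in U -> f X = 0) ->
  exists2 p, deg_lt heav (n - codim M G) p &
    forall X, X \in M -> Flat X = G -> f X = p X.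
Proof.
move=> UM dU dGU fP f0.
have [p [r [pP rP fE]]] := flat_span_split G (vanishing_flat_span UM dU fP f0).
exists p => // X XM XG; rewrite fE (flat_span_vanish dGU rP) ?XG ?setU11 //.
by rewrite addr0 /flat_ind XG subxx mul1r.
Qed.

Theorem extend_flat G n p : G \in flats M -> deg_lt heav (n - codim M G) p ->
  exists2 f, deg_lt heav n f &
    forall X, X \in M -> f X = if G \subset Flat X then p X else 0.
Proof.
move=> GM pP; have [nc|cn] := ltnP n (codim M G).
  rewrite (eqP (ltnW nc : (n - codim M G)%N == 0%N)) in pP.
  exists (fun=> 0); first exact: fspan0.
  by move=> X _; rewrite (deg_lt0 pP) if_same.
have [B Bsp BG] := codim_basis hM GM.
have BP := deg_lt_prod_set (A := B) (fun i _ => deg_lt_ind K i None).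
exists (fun X => \prod_(i in B) ind i None X * p X).
  by apply: fspan_mono (fspan_mul BP pP) _; rewrite BG; lia.
move=> X XM; have := flat_ind_spans Bsp XM; rewrite /ind prod_bool /flat_ind.
have -> : [forall i in B, X i == None] = (B \subset Flat X).
  by apply/forall_inP/subsetP => H i /H; rewrite inE.
by move=> <-; case: ifP => _; rewrite ?mul1r ?mul0r.
Qed.

End Decomposition.

(** * Dimensions of quotients *)

Definition lin_closed (K : fieldType) (V : lmodType K) (W : V -> Prop) :=
  W 0 /\ forall a x y, W x -> W y -> W (a *: x + y).

Section LinearClosed.
Variables (K : fieldType) (V : lmodType K) (W : V -> Prop).
Hypothesis hW : lin_closed W.

Lemma lin_closedZ a x : W x -> W (a *: x).
Proof. by move=> Wx; rewrite -[_ *: _]addr0; apply: hW.2 => //; apply: hW.1. Qed.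

Lemma lin_closedD x y : W x -> W y -> W (x + y).
Proof. by move=> Wx; rewrite -[x]scale1r; apply: hW.2. Qed.

Lemma lin_closedB x y : W x -> W y -> W (x - y).
Proof. by move=> Wx Wy; rewrite addrC -scaleN1r; apply: hW.2. Qed.

Lemma lin_closed_sum n (F : 'I_n -> V) : (forall i, W (F i)) -> W (\sum_i F i).
Proof.
move=> FW; elim/big_rec: _ => [|i x _ Wx]; first exact: hW.1.
exact: lin_closedD.
Qed.

End LinearClosed.

Section QuotientDimension.
Variables (K : fieldType) (V : vectType K).
Implicit Types (W U : V -> Prop) (A B : {vspace V}).

Definition carves A W := forall x, x \in A <-> W x.

(** A maximal subspace inside [W] is all of [W], by excluded middle. *)
Lemma vspace_exists W : lin_closed W -> exists A, carves A W.
Proof.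
move=> hW.
have grow k : forall A, (\dim {:V} - \dim A < k)%N -> (forall x, x \in A -> W x) ->
    exists A, carves A W.
  elim: k => // k IHk A Ak AW.
  have [[x [Wx xA]]|none] :=
      ClassicalEpsilon.excluded_middle_informative (exists x, W x /\ x \notin A).
    apply: (IHk (A + <[x]>)%VS) => [|y /memv_addP[a aA [_ /vlineP[c ->] ->]]].
      have lt : (\dim A < \dim (A + <[x]>))%N.
        rewrite ltnNge; apply: contra xA => le.
        have /eqP -> : A == (A + <[x]>)%VS by rewrite eqEdim addvSl.
        by apply: (subvP (addvSr _ _)); apply: memv_line.
      have := dimvS (subvf (A + <[x]>)); lia.
    by rewrite addrC; apply: hW.2 => //; apply: AW.
  exists A => x; split=> [/AW //|Wx]; apply/negPn/negP=> xA.
  by case: none; exists x.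
apply: (grow (\dim {:V}).+1 0%VS) => [|x]; first by rewrite ltnS leq_subr.
by rewrite memv0 => /eqP->; apply: hW.1.
Qed.

Definition vspace_of W : {vspace V} :=
  ClassicalEpsilon.epsilon (inhabits 0%VS) (fun A => carves A W).

Lemma vspace_ofP W : lin_closed W -> carves (vspace_of W) W.
Proof. by move=> /vspace_exists; apply: ClassicalEpsilon.epsilon_spec. Qed.

Lemma quot_basis_vspace W U A B : carves A W -> carves B U -> (B <= A)%VS ->
  exists v : 'I_(\dim A - \dim B) -> V, quot_basis W U v.
Proof.
move=> AW BU BA; pose D := (A :\: B)%VS.
have DB0 : (D :&: B)%VS = 0%VS by apply: capv_diff.
have DBA : (D + B)%VS = A by rewrite -[RHS](addv_diff_cap A B) (capv_idPr BA).
have dimD : (\dim A - \dim B)%N = \dim D.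
  by rewrite -DBA dimv_disjoint_sum // addnK.
have bD := vbasisP D.
rewrite dimD; exists (fun i => (vbasis D)`_i); split.
- move=> i; apply/AW; rewrite -DBA; apply: (subvP (addvSl _ _)).
  by apply: vbasis_mem; apply: mem_nth; rewrite size_tuple.
- move=> c /BU cB i; have cD : \sum_i c i *: (vbasis D)`_i \in D.
    by apply: memv_suml => j _; apply: memvZ; apply: vbasis_mem;
       apply: mem_nth; rewrite size_tuple.
  have /freeP := basis_free bD; apply.
  by apply/eqP; rewrite -memv0 -DB0 memv_cap cD.
- move=> w /AW; rewrite -DBA => /memv_addP[d dD [b bB ->]].
  exists (fun i => coord (vbasis D) i d); apply/BU.
  by rewrite -(coord_vbasis dD) addrC addKr.
Qed.

End QuotientDimension.

Lemma dim_exact (K : fieldType) (V V' : vectType K) (f : V -> V')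
    (A B : {vspace V}) (C : {vspace V'}) :
    linear f -> (forall x, x \in A -> f x \in C) ->
    (forall y, y \in C -> exists2 x, x \in A & f x = y) ->
    (forall x, x \in B <-> x \in A /\ f x = 0) ->
  \dim A = (\dim B + \dim C)%N.
Proof.
move=> flin fA fC fB.
pose fL : {linear V -> V'} := HB.pack f (GRing.isLinear.Build _ _ _ _ f flin).
pose g := linfun fL; have gE x : g x = f x by rewrite lfunE.
rewrite -(limg_ker_dim g A); congr addn; congr dimv; apply/vspaceP => x.
  rewrite memv_cap memv_ker gE; apply/andP/idP => [[xA /eqP xf]|/fB[-> ->]] //.
  by apply/fB.
apply/memv_imgP/idP => [[y yA ->]|/fC[y yA <-]]; first by rewrite gE fA.
by exists y => //; rewrite gE.
Qed.

(** A linear map that identifies the image of [W] modulo [U] with that of [W']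
modulo [U'] carries bases back.  The source may have infinite dimension, which
is the case for polynomial rings. *)
Lemma quot_basis_transfer (K : fieldType) (V V' : lmodType K) (f : V -> V')
    (W U : V -> Prop) (W' U' : V' -> Prop) n (v' : 'I_n -> V') :
    linear f -> lin_closed W -> lin_closed U' ->
    (forall p, W p -> W' (f p)) ->
    (forall y, W' y -> exists2 p, W p & U' (y - f p)) ->
    (forall p, W p -> U p <-> U' (f p)) ->
    quot_basis W' U' v' ->
  exists v : 'I_n -> V, quot_basis W U v.
Proof.
move=> flin hW hU' fW fsurj fU [W'v free gen].
pose fL : {linear V -> V'} := HB.pack f (GRing.isLinear.Build _ _ _ _ f flin).
have [v vW vU] := fin_all_exists2 (fun i => fsurj _ (W'v i)).
have comb (c : 'I_n -> K) : f (\sum_i c i *: v i) = \sum_i c i *: f (v i).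
  by rewrite -[f]/(fL : V -> V') linear_sum; apply: eq_bigr => i _; rewrite linearZ.
have diff (c : 'I_n -> K) : U' (\sum_i c i *: v' i - f (\sum_i c i *: v i)).
  rewrite comb -sumrB; apply: lin_closed_sum => // i.
  rewrite -scalerBr; apply: (lin_closedZ hU'); exact: vU.
have Wc (c : 'I_n -> K) : W (\sum_i c i *: v i).
  by apply: lin_closed_sum => // i; apply: lin_closedZ.
exists v; split=> // [c /(fU _ (Wc c)) Uc|w Ww].
  apply: free; rewrite -[X in U' X](subrK (f (\sum_i c i *: v i))).
  exact: (lin_closedD hU' (diff c) Uc).
have [c Uc] := gen _ (fW _ Ww); exists c.
apply/fU; first exact: lin_closedB.
rewrite -[f]/(fL : V -> V') linearB /=.
have -> : f w - f (\sum_i c i *: v i) = (f w - \sum_i c i *: v' i) +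
    (\sum_i c i *: v' i - f (\sum_i c i *: v i)) by rewrite addrA subrK.
exact: (lin_closedD hU' Uc (diff c)).
Qed.

(** * The filtration of the Varchenko--Gelfand rings *)

Section Filtration.
Variables (K : fieldType) (I : finType).
Implicit Types (P : {set sset I}).

Definition fil P (n : nat) (f : VG K P) : Prop :=
  exists2 phi, deg_lt (@heaviside_gens K I) n phi & forall X, f X = phi (val X).

Lemma fil_closed P n : lin_closed (@fil P n).
Proof.
split=> [|a f g [phi phiP fE] [psi psiP gE]].
  by exists (fun=> 0) => [|X]; [exact: fspan0 | rewrite ffunE].
exists (fun X => a * phi X + psi X); first exact: fspan_lin phiP psiP _.
by move=> X; rewrite !ffunE fE gE.
Qed.

Lemma fil_mono P m n f : @fil P m f -> (m <= n)%N -> fil n f.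
Proof. by move=> [phi phiP fE] mn; exists phi => //; apply: fspan_mono mn. Qed.

Lemma filE P n f : @fil P n f <-> exists p : {mpoly K[#|{: I * bool}|]},
  (msize p <= n)%N /\ forall X, f X = peval p (heaviside K (val X)).
Proof.
have gens phi : deg_lt (@heaviside_gens K I) n phi <->
    deg_lt (fun a => exists j, a =1 fun X => heaviside K X j) n phi.
  split; apply: (deg_lt_pull (t := id)) => a.
    move=> [i [b ->]]; apply: deg_lt_gen; exists (i, b) => X.
    by rewrite /= /ind ffunE.
  case=> -[i b] aE; apply: fspan_ext (deg_lt_ind K i (Some b)) _ => X /=.
  by rewrite aE ffunE.
split=> [[phi /gens/deg_lt_mpoly[p [pn pE]] fE]|[p [pn pE]]].
  by exists p; split=> // X; rewrite fE pE.
exists (fun X => peval p (heaviside K X)) => //.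
by apply/gens/deg_lt_mpoly; exists p.
Qed.

(** The three indicators of the locus give the same filtration as the two Heaviside
functions, since [h_i^0 = 1 - h_i^+ - h_i^-] has degree one. *)
Lemma fil_locus P n f : @fil P n f <-> exists p : {mpoly K[#|{: I * sign}|]},
  (msize p <= n)%N /\ forall X, f X = peval p (locus_point K (val X)).
Proof.
have gens phi : deg_lt (@heaviside_gens K I) n phi <->
    deg_lt (fun a => exists j, a =1 fun X => locus_point K X j) n phi.
  split; apply: (deg_lt_pull (t := id)) => a.
    move=> [i [b ->]]; apply: deg_lt_gen; exists (i, Some b) => X.
    by rewrite /= /ind ffunE.
  case=> -[i s] aE; apply: fspan_ext (deg_lt_ind K i s) _ => X /=.
  by rewrite aE ffunE.
split=> [[phi /gens/deg_lt_mpoly[p [pn pE]] fE]|[p [pn pE]]].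
  by exists p; split=> // X; rewrite fE pE.
exists (fun X => peval p (locus_point K X)) => //.
by apply/gens/deg_lt_mpoly; exists p.
Qed.

Lemma VG_filtE P k f : @VG_filt K I P k f <-> fil k.+1 f.
Proof. by rewrite filE. Qed.

Lemma VG_filt_predE P k f : @VG_filt_pred K I P k f <-> fil k f.
Proof.
case: k => [|k]; last exact: VG_filtE.
split=> [-> | [phi /deg_lt0 phi0 fE]]; first exact: (fil_closed P 0).1.
by apply/ffunP=> X; rewrite fE phi0 ffunE.
Qed.

(** The same space with its finite-dimensional structure. *)
Definition VGvect P : vectType K := {ffun {X : sset I | X \in P} -> K^o}.

Definition filv P n : {vspace VGvect P} := vspace_of (@fil P n : VGvect P -> Prop).

Lemma filvP P n : carves (filv P n) (@fil P n).
Proof. exact/vspace_ofP/fil_closed. Qed.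

Lemma filv_mono P m n : (m <= n)%N -> (filv P m <= filv P n)%VS.
Proof. by move=> mn; apply/subvP=> f /filvP fm; apply/filvP; apply: fil_mono mn. Qed.

Lemma VG_quot_basis P k :
  exists v : 'I_(\dim (filv P k.+1) - \dim (filv P k)) -> VG K P,
    quot_basis (@VG_filt K I P k) (@VG_filt_pred K I P k) v.
Proof.
apply: (@quot_basis_vspace K (VGvect P)); last exact: filv_mono.
  by move=> f; rewrite filvP; apply: iff_sym; apply: VG_filtE.
by move=> f; rewrite filvP; apply: iff_sym; apply: VG_filt_predE.
Qed.

Lemma VG_filt_pred_closed P k : lin_closed (@VG_filt_pred K I P k).
Proof.
have [h0 hlin] := fil_closed P k.
split=> [|a x y]; first exact/VG_filt_predE.
by rewrite !VG_filt_predE; apply: hlin.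
Qed.

Lemma Hilb_grVGE P k :
  Hilb_grVG K P k = (\dim (filv P k.+1) - \dim (filv P k))%N.
Proof.
have [v vP] := VG_quot_basis P k.
by have [h0 hlin] := VG_filt_pred_closed P k; apply: quot_dimE vP.
Qed.

End Filtration.

(** * Orbit harmonics *)

Section GradedIdeal.
Variables (K : fieldType) (J : finType) (Z : seq {ffun J -> K}).
Local Notation R := {mpoly K[#|J|]}.
Implicit Types (p q g : R).

Lemma pevalD p q z : peval (p + q) z = peval p z + peval q z.
Proof. exact: mevalD. Qed.
Lemma pevalB p q z : peval (p - q) z = peval p z - peval q z.
Proof. exact: mevalB. Qed.
Lemma pevalM p q z : peval (p * q) z = peval p z * peval q z.
Proof. exact: mevalM. Qed.
Lemma pevalZ a p z : peval (a *: p) z = a * peval p z.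
Proof. exact: mevalZ. Qed.

Lemma gr_ideal_closed : lin_closed (@gr_ideal K J Z).
Proof.
split.
  exists 0%N, (fun=> 0), (fun=> 1); split; last by rewrite big_ord0.
  by case.
move=> c g h [n [a [f [fZ ->]]]] [m [b [e [eZ ->]]]].
exists (n + m)%N,
  (fun k => match split k with inl i => c%:MP * a i | inr j => b j end),
  (fun k => match split k with inl i => f i | inr j => e j end).
split=> [k|]; first by case: (split k).
rewrite big_split_ord scaler_sumr /=; congr (_ + _); apply: eq_bigr => i _.
  by rewrite (unsplitK (inl i) : split (lshift m i) = _) mul_mpolyC scalerAl.
by rewrite (unsplitK (inr i) : split (rshift n i) = _).
Qed.

Lemma msize_homog d p : p \is d.-homog -> (msize p <= d.+1)%N.
Proof.
by move=> /dhomogP hp; rewrite msizeE; apply/bigmax_leqP_seq => m /hp -> _.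
Qed.

Lemma pihomog_small d p : (msize p <= d)%N -> pihomog mdeg d p = 0.
Proof.
move=> pd; rewrite pihomogE big_seq_cond big_pred0 // => m.
by apply/andP=> -[/msize_mdeg_lt mp /eqP md]; move: pd; rewrite -md leqNgt mp.
Qed.

Lemma msize_sub_pihomog d p : (msize p <= d.+1)%N -> (msize (p - pihomog mdeg d p) <= d)%N.
Proof.
move=> pd; rewrite {1}(pihomog_partitionE pd) big_ord_recr /= addrK.
apply: leq_trans (mmeasure_sum _ _ _ _) _; apply/bigmax_leqP => i _.
by apply: leq_trans (msize_homog (pihomogP _ _ _)) (ltn_ord i).
Qed.

Lemma pihomog_homog d e p : p \is e.-homog ->
  pihomog mdeg d p = if e == d then p else 0.
Proof.
by move=> pe; case: eqVneq => [<-|ed]; [exact: pihomog_dE | exact: pihomog_ne0 pe].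
Qed.

Lemma pihomogM_homog d e p q : q \is e.-homog ->
  pihomog mdeg d (p * q) = if (e <= d)%N then pihomog mdeg (d - e) p * q else 0.
Proof.
move=> qe; rewrite (pihomog_partitionE (leqnn (mmeasure mdeg p))).
rewrite mulr_suml !raddf_sum /= mulr_suml; case: ifP => [ed|/negbT ed]; last first.
  apply: big1 => c _; rewrite (pihomog_homog _ (dhomogM (pihomogP _ _ _) qe)).
  by case: eqP => // cd; lia.
apply: eq_bigr => c _; rewrite (pihomog_homog _ (dhomogM (pihomogP _ _ _) qe)).
rewrite (pihomog_homog (d - e) (pihomogP _ _ _)).
have -> : (c + e == d)%N = (nat_of_ord c == d - e)%N by lia.
by case: ifP => // _; rewrite mul0r.
Qed.

(** Left to right: in an expression of [p] through top components only the
degree [d] part of each coefficient matters, and replacing every top component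
[t] of a vanishing [f] by [t - f] changes no value on the locus but lowers the
degree.  Right to left: [p] is the top component of [p - q]. *)
Lemma gr_idealP d p : p \is d.-homog ->
  gr_ideal Z p <-> exists2 q, (msize q <= d)%N &
    forall z, z \in Z -> peval p z = peval q z.
Proof.
move=> pd; split.
  move=> [n [a [f [fZ pE]]]].
  pose e i := (msize (f i)).-1.
  pose b i := if (e i <= d)%N then pihomog mdeg (d - e i) (a i) else 0.
  have pE' : p = \sum_i b i * top_component (f i).
    rewrite -(pihomog_dE pd) pE raddf_sum /=; apply: eq_bigr => i _.
    rewrite (pihomogM_homog _ _ (pihomogP _ _ _)) /b; case: ifP => // _.
    by rewrite mul0r.
  exists (- \sum_i b i * (f i - top_component (f i))).
    rewrite mmeasureN; apply: leq_trans (mmeasure_sum _ _ _ _) _.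
    apply/bigmax_leqP => i _; rewrite /b; case: ifP => [ed|_]; last first.
      by rewrite mul0r msize0.
    have [->|f0] := eqVneq (f i - top_component (f i)) 0; first by rewrite mulr0 msize0.
    have [->|a0] := eqVneq (pihomog mdeg (d - e i) (a i)) 0; first by rewrite mul0r msize0.
    have arith k l m : (m <= d -> k <= (d - m).+1 -> l <= m -> (k + l).-1 <= d)%N.
      lia.
    rewrite msizeM //; apply: arith ed (msize_homog (pihomogP _ _ _)) _.
    exact: msize_sub_pihomog (leqSpred _).
  move=> z zZ; apply/eqP; rewrite -subr_eq0 -pevalB opprK pE' -big_split /=.
  apply/eqP; apply: (big_ind (fun r => peval r z = 0)).
  - exact: meval0.
  - by move=> r s r0 s0; rewrite pevalD r0 s0 addr0.
  - move=> i _; rewrite -mulrDr addrC subrK pevalM.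
    by have [-> //] := fZ i; rewrite mulr0.
move=> [q qd pq].
have [->|p0] := eqVneq p 0; first exact: gr_ideal_closed.1.
have topE : top_component (p - q) = p.
  have sizep : msize p = d.+1.
    have := dhomog_uniq p0 pd (dhomog_msize pd).
    by move: p0; rewrite -msize_poly_eq0; case: (msize p) => //= m _ ->.
  have sizepq : msize (p - q) = d.+1.
    apply/eqP; rewrite eqn_leq; apply/andP; split.
      apply: leq_trans (msizeD_le _ _) _.
      by rewrite mmeasureN geq_max sizep leqnn ltnW.
    rewrite ltnNge; apply/negP=> small.
    have := msizeD_le (p - q) q; rewrite subrK sizep leqNgt ltnS.
    by rewrite geq_max small qd.
  by rewrite /top_component sizepq raddfB /= pihomog_dE // pihomog_small ?subr0.
exists 1%N, (fun=> 1), (fun=> p - q); split=> [_|].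
  split; last by apply: contraNneq p0 => E; rewrite -topE E /top_component raddf0.
  by move=> z zZ; rewrite pevalB pq ?subrr.
by rewrite big_ord1 mul1r topE.
Qed.

End GradedIdeal.

Section BigRing.
Variables (K : fieldType) (I : finType) (M : {set sset I}).
Local Notation R := {mpoly K[#|{: I * sign}|]}.

Definition locus_eval (p : R) : VG K M := [ffun X => peval p (locus_point K (val X))].

Lemma locus_eval_linear : linear locus_eval.
Proof. by move=> c p q; apply/ffunP=> X; rewrite !ffunE pevalD pevalZ. Qed.

Lemma big_locusP (z : {ffun I * sign -> K}) :
  reflect (exists2 X, X \in M & z = locus_point K X) (z \in big_locus K M).
Proof. exact: imageP. Qed.

Lemma fil_locus_eval n (f : VG K M) :
  fil n f <-> exists2 p, (msize p <= n)%N & f = locus_eval p.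
Proof.
rewrite fil_locus; split=> [[p [pn pE]]|[p pn ->]]; exists p => //.
  by apply/ffunP=> X; rewrite ffunE.
by split=> // X; rewrite ffunE.
Qed.

Lemma Hilb_OH_big d : Hilb_bigVG K M d = Hilb_OH (big_locus K M) d.
Proof.
have [v' v'P] := VG_quot_basis K M d.
have homogW : lin_closed (fun p : R => p \is d.-homog).
  by split=> [|a x y xd yd]; [exact: rpred0 | exact: rpredD (rpredZ a xd) yd].
have [|||v vP] := quot_basis_transfer (U := gr_ideal (big_locus K M))
  locus_eval_linear homogW (VG_filt_pred_closed K M d) _ _ _ v'P.
- by move=> p pd; apply/VG_filtE/fil_locus_eval; exists p => //; apply: msize_homog.
- move=> _ /VG_filtE/fil_locus_eval[p pd ->].
  exists (pihomog mdeg d p); first exact: pihomogP.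
  apply/VG_filt_predE/fil_locus_eval; exists (p - pihomog mdeg d p).
    exact: msize_sub_pihomog.
  by apply/ffunP=> X; rewrite !ffunE pevalB.
- move=> p pd; rewrite VG_filt_predE fil_locus_eval (gr_idealP _ pd).
  split=> -[q qd pq]; exists q => //.
    apply/ffunP=> X; rewrite !ffunE; apply: pq; apply/big_locusP.
    by exists (val X) => //; apply: valP.
  move=> z /big_locusP[X XM ->]; have /ffunP/(_ (exist _ X XM)) := pq.
  by rewrite !ffunE.
have [g0 glin] := gr_ideal_closed (big_locus K M).
rewrite /Hilb_bigVG Hilb_grVGE; exact: esym (quot_dimE g0 glin vP).
Qed.

End BigRing.

(** * Contractions and the dimension count *)

Section Contraction.
Variables (I : finType) (M : {set sset I}) (F : {set I}).
Local Notation J := {i : I | i \notin F}.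

Definition lift_sset (Y : sset J) : sset I :=
  [ffun i => if insub i is Some j then Y j else None].

Lemma lift_sset_val Y (j : J) : lift_sset Y (val j) = Y j.
Proof. by rewrite ffunE valK. Qed.

Lemma lift_sset_out Y i : i \in F -> lift_sset Y i = None.
Proof. by move=> iF; rewrite ffunE insubF // iF. Qed.

Lemma lift_ssetK : cancel lift_sset (restr F).
Proof. by move=> Y; apply/ffunP=> j; rewrite ffunE lift_sset_val. Qed.

Lemma restrK (X : sset I) : F \subset Flat X -> lift_sset (restr F X) = X.
Proof.
move=> /subsetP FX; apply/ffunP=> i; have [iF|iF] := boolP (i \in F).
  by rewrite lift_sset_out //; have := FX i iF; rewrite inE => /eqP.
have -> : i = val (exist _ i iF : J) by [].
by rewrite lift_sset_val ffunE.
Qed.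

Lemma topes_contraction (Y : sset J) :
  (Y \in topes (contraction M F)) = (lift_sset Y \in M) && (Flat (lift_sset Y) == F).
Proof.
rewrite inE; apply/andP/andP => [[/imsetP[X]]|[YM /eqP YF]].
  rewrite inE => /andP[XM /forall_inP XF] YE /forallP Y0.
  have FX : F \subset Flat X by apply/subsetP=> i /XF; rewrite inE.
  rewrite YE restrK //; split=> //; rewrite eqEsubset FX andbT.
  apply/subsetP=> i; rewrite inE; apply: contraLR => iF.
  by have := Y0 (exist _ i iF); rewrite YE ffunE.
split; last first.
  apply/forallP=> j; rewrite -lift_sset_val; move: (valP j) => /=.
  by move: (val j) => i; rewrite -{1}YF inE.
apply/imsetP; exists (lift_sset Y); last by rewrite lift_ssetK.
by rewrite inE YM; apply/forall_inP=> i iF; rewrite lift_sset_out.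
Qed.

End Contraction.

Section Dimension.
Variables (K : fieldType) (I : finType) (M : {set sset I}).
Hypothesis hM : is_COM M.
Implicit Types (F G : {set I}) (U : {set {set I}}).

(** The filtered piece of the functions that vanish over the flats in [U]. *)
Definition fil_off n U (f : VG K M) : Prop :=
  fil n f /\ forall X, Flat (val X) \in U -> f X = 0.

Lemma fil_off_closed n U : lin_closed (@fil_off n U).
Proof.
have [h0 hlin] := fil_closed K M n; split.
  by split=> // X _; rewrite ffunE.
move=> a f g [fn f0] [gn g0]; split=> [|X XU]; first exact: hlin.
by rewrite !ffunE f0 // g0 // scaler0 addr0.
Qed.

Definition filv_off n U : {vspace VGvect K M} :=
  vspace_of (@fil_off n U : VGvect K M -> Prop).

Lemma filv_offP n U : carves (filv_off n U) (@fil_off n U).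
Proof. exact/vspace_ofP/fil_off_closed. Qed.

(** Extension by zero, total so that [res] can be defined without proofs of
membership. *)
Definition ext0 (f : VG K M) (X : sset I) : K :=
  if insub X is Some x then f x else 0.

Lemma ext0E f X (XM : X \in M) : ext0 f X = f (exist _ X XM).
Proof. by rewrite /ext0 insubT. Qed.

Lemma ext0_val f (x : {X : sset I | X \in M}) : ext0 f (val x) = f x.
Proof. by rewrite /ext0 valK. Qed.

Definition res F (f : VG K M) : VG K (topes (contraction M F)) :=
  [ffun Y => ext0 f (lift_sset (val Y))].

Lemma res_linear F : linear (res F).
Proof.
move=> a f g; apply/ffunP=> Y; rewrite !ffunE /ext0.
by case: insub => [x|]; rewrite ?ffunE //= scaler0 addr0.
Qed.

Lemma fil_res G U n f : U \subset flats M -> downset M U -> downset M (G |: U) ->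
  fil_off n U f -> fil (n - codim M G) (res G f).
Proof.
move=> UM dU dGU [[phi phiP fE] f0].
have [X XM XU|p pP pE] := restrict_flat hM UM dU dGU phiP.
  by have := f0 (exist _ X XM) XU; rewrite fE.
exists (p \o @lift_sset I G).
  apply: deg_lt_pull pP => a [i [b ->]].
  have [iG|iG] := boolP (i \in G).
    by apply: fspan0 => Y; rewrite /= /ind lift_sset_out.
  apply: fspan_ext (deg_lt_ind K (exist _ i iG : {i | i \notin G}) (Some b)) _ => Y.
  by rewrite /= /ind -(lift_sset_val Y (exist _ i iG)).
move=> Y; have := valP Y; rewrite topes_contraction => /andP[YM /eqP YG].
by rewrite ffunE /= -pE // ext0E fE.
Qed.

Lemma res_onto G U n g : G \in flats M -> G \notin U -> downset M U ->
    @fil K _ (topes (contraction M G)) (n - codim M G) g ->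
  exists2 f, fil_off n U f & res G f = g.
Proof.
move=> GM GU dU [phi phiP gE].
have phiP' : deg_lt (@heaviside_gens K I) (n - codim M G) (phi \o restr G).
  apply: deg_lt_pull phiP => a [j [b ->]].
  apply: fspan_ext (deg_lt_ind K (val j) (Some b)) _ => X.
  by rewrite /= /ind ffunE.
have [psi psiP psiE] := extend_flat hM GM phiP'.
exists [ffun X => psi (val X)].
  split; first by exists psi => // X; rewrite ffunE.
  move=> X XU; rewrite ffunE psiE ?(valP X) //; case: ifP => // GX.
  by rewrite (dU _ _ GM XU GX) in GU.
apply/ffunP=> Y; have := valP Y; rewrite topes_contraction => /andP[YM /eqP YG].
by rewrite ffunE gE ext0E ffunE psiE // YG subxx /= lift_ssetK.
Qed.

Lemma res_ker G U n f :
  fil_off n (G |: U) f <-> fil_off n U f /\ res G f = 0.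
Proof.
split=> [[fn f0]|[[fn f0] fG]].
  split; first by split=> // X XU; apply: f0; rewrite setU1r.
  apply/ffunP=> Y; have := valP Y; rewrite topes_contraction => /andP[YM /eqP YG].
  rewrite !ffunE ext0E.
  by apply: f0; rewrite /= YG setU11.
split=> // X /setU1P[XG|]; last exact: f0.
have XT : restr G (val X) \in topes (contraction M G).
  by rewrite topes_contraction restrK ?XG // (valP X) /=.
have /ffunP/(_ (exist _ (restr G (val X)) XT)) := fG; rewrite !ffunE /= restrK ?XG //.
by rewrite ext0_val.
Qed.

(** Removing a maximal flat [G] from [U] leaves a down-set; restriction to [G] is
then onto a filtered piece of the contraction, with kernel the functions that
vanish over all of [U]. *)
Lemma dim_filv_off n U : U \subset flats M -> downset M U ->
  \dim (filv K M n) = (\dim (filv_off n U) +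
    \sum_(F in U) \dim (filv K (topes (contraction M F)) (n - codim M F)))%N.
Proof.
have [k] := ubnP #|U|; elim: k U => // k IHk U Uk UM dU.
have [->|U0] := eqVneq U set0.
  rewrite big_set0 addn0; congr dimv; apply/vspaceP => f.
  apply/idP/idP=> [/filvP fn|/filv_offP[fn _]]; last exact/filvP.
  by apply/filv_offP; split=> // X; rewrite inE.
have [G GU dU'] := downset_maximal U0 dU.
have UM' : U :\ G \subset flats M by apply: subset_trans UM; apply: subD1set.
have GM := subsetP UM G GU.
have GU' : G \notin U :\ G by rewrite !inE eqxx.
rewrite (cardsD1 G U) GU in Uk.
rewrite (IHk (U :\ G)) // (big_setD1 G GU) /= addnA; congr addn.
rewrite -{2}(setD1K GU).
apply: (dim_exact (res_linear G)).
- move=> f /filv_offP fn; apply/filvP; apply: fil_res fn => //.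
  by rewrite setD1K.
- move=> g /filvP gn; have [f fn fg] := res_onto GM GU' dU' gn.
  by exists f => //; apply/filv_offP.
- move=> f; split.
    by move=> /filv_offP/res_ker[fn f0]; split=> //; apply/filv_offP.
  by move=> [/filv_offP fn f0]; apply/filv_offP/res_ker.
Qed.

Theorem dim_filv n : \dim (filv K M n) =
  (\sum_(F in flats M) \dim (filv K (topes (contraction M F)) (n - codim M F)))%N.
Proof.
rewrite (dim_filv_off n (subxx _)) => [|F G FM _ _ //].
suff -> : filv_off n (flats M) = 0%VS by rewrite dimv0.
apply/eqP; rewrite -subv0; apply/subvP=> f /filv_offP[_ f0]; rewrite memv0.
apply/eqP/ffunP=> X; rewrite f0 ?ffunE //; apply: imset_f; exact: valP.
Qed.

End Dimension.

Theorem corollary4p15 (K : fieldType) (I : finType) (M : {set sset I})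
    (hM : is_COM M) :
  (forall d : nat, Hilb_bigVG K M d = Hilb_OH (big_locus K M) d) /\
  (forall d : nat, Hilb_OH (big_locus K M) d =
    (\sum_(F in flats M)
       qshift (codim M F) (Hilb_smallVG K (contraction M F)) d)%N).
Proof.
split=> d; first exact: Hilb_OH_big.
rewrite -Hilb_OH_big /Hilb_bigVG Hilb_grVGE !(dim_filv K hM) -sumnB; last first.
  by move=> F _; apply/dimvS/filv_mono/leq_sub2r.
apply: eq_bigr => F _; rewrite /qshift /Hilb_smallVG; case: leqP => cd.
  by rewrite Hilb_grVGE subSn.
by rewrite (eqP (cd : (d.+1 - _)%N == 0%N)) (eqP (ltnW cd : (d - _)%N == 0%N)) subnn.
Qed.
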